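(* Consider the probabilistic bisection algorithm with power-one tests described in the context, with the uniform prior $f_0\equiv 1$ on $[0,1]$. Suppose that: (1) $x^*\in[0,1]$, $g(x)>0$ for $x<x^*$ and $g(x)<0$ for $x>x^*$; (2) $\tilde p(x)>1/2$ for every $x\neq x^*$; (3) almost surely, $X_n\neq x^*$ for all $n=0,1,2,\ldots$; (4) there is $c>0$ such that $\tilde p(x)-1/2\ge c|x-x^*|$ for all $x\in[0,1]$. Let $\epsilon\in(0,1/2)$ and, for $n\ge1$, let $$\hat X_n(\epsilon)=\frac{\sum_{i=0}^{n-1}N_i^{1/2-\epsilon}X_i}{\sum_{i=0}^{n-1}N_i^{1/2-\epsilon}},\qquad T_{n-1}=\sum_{i=0}^{n-1}N_i .$$ Then the family of random variables $\{|\hat X_n(\epsilon)-x^*|\,T_{n-1}^{1/2-\epsilon}: n\ge 1\}$ is tight.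
   Context: Observations. $g:[0,1]\to\mathbb{R}$ is a function and $x^*\in[0,1]$. Nothing is assumed about $g(x^* )$. Evaluating at $x\in[0,1]$ returns $Y(x)=g(x)+\epsilon(x)$, where the noise $\epsilon(x)$ is independent of all previous evaluations and repeated evaluations at the same $x$ are i.i.d. (the noise $\epsilon(x)$ is unrelated to the number $\epsilon$ in the claim). Put $\tilde Z(x)=1$ if $Y(x)\ge 0$ and $\tilde Z(x)=-1$ if $Y(x)<0$. Define $\tilde p(x)=P(\tilde Z(x)=1)$ if $x\le x^*$ and $\tilde p(x)=P(\tilde Z(x)=-1)$ if $x>x^*$. Parameters. Fix $\gamma\in(0,1)$, $p_c=1-\gamma/2$, $p\in(1/2,p_c)$, $q=1-p$, and $k_m=(2m(\ln(m+1)-\ln\gamma))^{1/2}$ for $m\ge1$. Algorithm. Start from the prior density $f_0$ on $[0,1]$. For $n=0,1,2,\ldots$: let $X_n$ be the median of the density $f_n$. Make successive evaluations at $X_n$, which given the past are i.i.d. copies at the point $X_n$, with signs $\tilde Z_{n,1},\tilde Z_{n,2},\ldots$ (distributed as $\tilde Z(X_n)$). Let $S_{n,m}=\sum_{i=1}^m\tilde Z_{n,i}$ and $N_n=\inf\{m\ge1:|S_{n,m}|\ge k_m\}$ (a.s. finite when $X_n\ne x^*$). Set $Z_n=+1$ if $S_{n,N_n}>0$ and $Z_n=-1$ if $S_{n,N_n}<0$. If $Z_n=+1$, put $f_{n+1}(y)=2pf_n(y)$ for $y\ge X_n$ and $f_{n+1}(y)=2qf_n(y)$ for $y<X_n$.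 If $Z_n=-1$, put $f_{n+1}(y)=2qf_n(y)$ for $y\ge X_n$ and $f_{n+1}(y)=2pf_n(y)$ for $y<X_n$. A family of real random variables $\{W_n\}$ is tight if for every $\eta>0$ there is $M<\infty$ with $P(|W_n|>M)<\eta$ for all $n$. *)

(* Defs.v *)
From HB Require Import structures.
From mathcomp Require Import all_boot all_order all_algebra.
From mathcomp Require Import all_classical all_reals all_analysis.
Set Implicit Arguments.
Unset Strict Implicit.
Unset Printing Implicit Defensive.
Import Order.TTheory GRing.Theory Num.Theory.
Import numFieldNormedType.Exports.
Local Open Scope classical_set_scope.
Local Open Scope ring_scope.

(* Sequential test of power one, as a function of the infinite sequence
   [y : nat -> R] of evaluations available at the point under test.
   Evaluations are numbered from 0: [y i] is evaluation number i + 1. *)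
Section PowerOneTest.
Context {R : realType}.
Implicit Types (gamma : R) (y : nat -> R) (m : nat).

Definition ztilde (v : R) : R := if 0 <= v then 1 else -1.

Definition walk y m : R := \sum_(i < m) ztilde (y i).

Definition boundary gamma m : R :=
  Num.sqrt (2 * m%:R * (ln m.+1%:R - ln gamma)).

Definition exits gamma y m : bool :=
  (1 <= m)%N && (boundary gamma m <= `|walk y m|).

(* The test length.  It is given the dummy value 0 when the infimum is that of
   the empty set, i.e. when the test never stops. *)
Definition stop_time gamma y : nat :=
  if pselect (exists m, exits gamma y m) is left h then ex_minn h else 0%N.

(* [true] stands for the sign +1 and [false] for -1; as [boundary] is positive
   for m >= 1 and 0 < gamma < 1, the walk is nonzero when the test stops. *)
Definition test_sign gamma y : bool := 0 < walk y (stop_time gamma y).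

(* Evaluation [y i] is actually made, i.e. the test has not stopped before. *)
Definition observed gamma y (i : nat) : Prop :=
  forall m, (m <= i)%N -> ~~ exits gamma y m.

End PowerOneTest.

(* The algorithm, pathwise: [e n i] is the noise of evaluation number i + 1
   at stage n. *)
Section ProbabilisticBisection.
Context {R : realType}.
Implicit Types (f g : R -> R) (p gamma x : R) (e : nat -> nat -> R) (n : nat).

Definition is_median f x : Prop :=
  [/\ 0 <= x <= 1,
      (\int[lebesgue_measure]_(y in `[0%R, x]) (f y)%:E)%E = (2^-1)%:E &
      (\int[lebesgue_measure]_(y in `[x, 1%R]) (f y)%:E)%E = (2^-1)%:E].

(* The densities met by the algorithm are positive on [0, 1], so that their
   median exists and is unique. *)
Definition median f : R := xget 0 [set x | is_median f x].

Definition uniform_density : R -> R := \1_(`[0, 1]).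

Definition update p f x (up : bool) : R -> R := fun y =>
  if up then (if x <= y then 2 * p * f y else 2 * (1 - p) * f y)
  else (if x <= y then 2 * (1 - p) * f y else 2 * p * f y).

Definition evaluations g x (noise : nat -> R) : nat -> R :=
  fun i => g x + noise i.

Fixpoint pba_density g gamma p f0 e n : R -> R :=
  if n is n'.+1 then
    let f := pba_density g gamma p f0 e n' in
    let x := median f in
    update p f x (test_sign gamma (evaluations g x (e n')))
  else f0.

Definition pba_X g gamma p f0 e n : R := median (pba_density g gamma p f0 e n).

Definition pba_Y g gamma p f0 e n : nat -> R :=
  evaluations g (pba_X g gamma p f0 e n) (e n).

Definition pba_N g gamma p f0 e n : nat :=
  stop_time gamma (pba_Y g gamma p f0 e n).

Definition pba_T g gamma p f0 e n : nat :=
  (\sum_(i < n) pba_N g gamma p f0 e i)%N.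

Definition pba_Xhat g gamma p f0 (eps : R) e n : R :=
  (\sum_(i < n) (pba_N g gamma p f0 e i)%:R `^ (2^-1 - eps)
                * pba_X g gamma p f0 e i)
  / \sum_(i < n) (pba_N g gamma p f0 e i)%:R `^ (2^-1 - eps).

End ProbabilisticBisection.

Section Stochastics.
Context {R : realType}.

(* [nu x] is the law of the noise at x. *)
Definition ptilde (nu : R -> probability (measurableTypeR R) R)
    (g : R -> R) (xstar x : R) : R :=
  if x <= xstar then fine (nu x [set v | ztilde (g x + v) = 1])
  else fine (nu x [set v | ztilde (g x + v) = -1]).

Context {d : measure_display} {T : measurableType d} (P : probability T R).

(* Sigma-algebra generated by the evaluations made before stage n. *)
Definition past (g : R -> R) (gamma p : R) (f0 : R -> R)
    (e : nat -> nat -> T -> R) (n : nat) : set (set T) :=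
  let Y m w := pba_Y g gamma p f0 (fun j i => e j i w) m in
  <<s [set A | exists m i (B : set (measurableTypeR R)),
        [/\ (m < n)%N, measurable B &
            A = [set w | observed gamma (Y m w) i /\ B (Y m w i)]]] >>.

(* Given the past and X_n = x, the noises of the evaluations of stage n are
   i.i.d. with law [nu x].  X_n takes finitely many values, so it is enough
   to condition on the atoms [X_n = x], and no measurability of [nu] in x is
   involved. *)
Definition cond_iid_noise (nu : R -> probability (measurableTypeR R) R)
    (g : R -> R) (gamma p : R) (f0 : R -> R)
    (e : nat -> nat -> T -> R) : Prop :=
  let X n w := pba_X g gamma p f0 (fun j i => e j i w) n in
  forall (n : nat) (A : set T) (x : R) (k : nat)
         (B : nat -> set (measurableTypeR R)),
    past g gamma p f0 e n A -> (forall i, measurable (B i)) ->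
    P (A `&` [set w | X n w = x]
         `&` [set w | forall i, (i < k)%N -> B i (e n i w)]) =
    (P (A `&` [set w | X n w = x])
     * (\prod_(i < k) fine (nu x (B i)))%:E)%E.

(* A measure has no meaning on non-measurable sets: that the W n are random
   variables is part of the claim. *)
Definition tight (I : Type) (W : I -> T -> R) : Prop :=
  (forall n, measurable_fun setT (W n)) /\
  forall eta : R, 0 < eta ->
    exists M : R, forall n, (P [set w | (M < `|W n w|)%R] < eta%:E)%E.

End Stochastics.

(* Main.v *)
(* Put a = 1/2 - eps, D_i = |X_i - xstar|.  As t^a is subadditive,
   |Xhat_n - xstar| T_{n-1}^a <= sum_i N_i^a D_i.

   A wrong test result has probability at most gamma/2: compare the likelihood
   of a wrong exit with its average over a uniform success probability.  So the
   bisection moves the wrong way with probability less than 1 - p, and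
   ln ((1 - F(xstar)) / (F(xstar+h) - F(xstar))), with F the posterior distribution
   function, is a nonnegative supermartingale that loses a fixed amount whenever
   X_n > xstar+h.  Hence the expected number of n with D_n > h is O(ln (1/h)), and
   sum_n E D_n^del is finite for every del > 0.

   By Chebyshev a test at distance D lasts longer than m with probability
   O(1 / (m D^(2 + del))).  With (1 - del) / a = 2 + 2 del, this makes
   P(N_i^a D_i > L D_i^del) at most a multiple of L^(-1/a) E D_i^del, summable
   in i, while sum_i D_i^del <= L up to probability O(1 / L). *)
Require Import Defs.
From HB Require Import structures.
From mathcomp Require Import all_boot all_order all_algebra.
From mathcomp Require Import all_classical all_reals all_analysis.
From mathcomp Require Import measurable_realfun ring lra.
Set Implicit Arguments.
Unset Strict Implicit.
Unset Printing Implicit Defensive.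
Import Order.TTheory GRing.Theory Num.Theory.
Import numFieldNormedType.Exports.
Local Open Scope classical_set_scope.
Local Open Scope ring_scope.

(** * Sums over bit strings and sign strings *)

(** Conditional expectations are avoided throughout. The query point is a function of the finite
    string of test results so far, and what a test has decided by time M is a function of its first
    M signs. So the probabilities and expectations are finite weighted sums over bit strings, and a
    martingale or supermartingale is an equality or inequality between a string and its two
    extensions. A test may never stop, so a wrong result is split into a wrong verdict by time M and
    no verdict by time M; the second part vanishes as M grows, provided the query point is not the
    root. The slack eps in the exponent pays for two losses: the logarithm in the boundary, which
    costs Chebyshev's bound a factor D^(-del), and the moment D^del that must be left over for
    summability over the stages. Balancing them is the equation 1 - del = a (2 + 2 del), solved by
    del = eps / (1 - eps). *)

Section TreeSums.
Context {R : realType}.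
Implicit Types (F G : seq bool -> R) (n : nat) (s : seq bool).

(* Bit strings carry the most recent bit first. *)
Fixpoint tree_sum n G : R :=
  if n is n'.+1 then tree_sum n' (fun s => G (true :: s) + G (false :: s))
  else G [::].

Lemma eq_tree_sum n F G : (forall s, size s = n -> F s = G s) ->
  tree_sum n F = tree_sum n G.
Proof.
elim: n F G => [|n IH] F G FG /=; first exact: FG.
by apply: IH => s sn; rewrite !FG //= sn.
Qed.

Lemma ler_tree_sum n F G : (forall s, size s = n -> F s <= G s) ->
  tree_sum n F <= tree_sum n G.
Proof.
elim: n F G => [|n IH] F G FG /=; first exact: FG.
by apply: IH => s sn; apply: lerD; apply: FG; rewrite /= sn.
Qed.

Lemma tree_sumD n F G :
  tree_sum n (fun s => F s + G s) = tree_sum n F + tree_sum n G.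
Proof.
elim: n F G => [//|n IH] F G /=; rewrite -IH.
by apply: eq_tree_sum => s _; rewrite addrACA.
Qed.

Lemma tree_sumZ n a F : tree_sum n (fun s => a * F s) = a * tree_sum n F.
Proof.
elim: n F => [//|n IH] F /=; rewrite -IH.
by apply: eq_tree_sum => s _; rewrite mulrDr.
Qed.

Lemma tree_sum_ge0 n F : (forall s, size s = n -> 0 <= F s) ->
  0 <= tree_sum n F.
Proof.
elim: n F => [|n IH] F F0 /=; first exact: F0.
by apply: IH => s sn; rewrite addr_ge0 ?F0 //= sn.
Qed.

Lemma tree_sum_flip n F : tree_sum n (F \o map negb) = tree_sum n F.
Proof.
elim: n F => [//|n IH] F /=.
rewrite -(IH (fun s => F (true :: s) + F (false :: s))).
by apply: eq_tree_sum => s _ /=; rewrite addrC.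
Qed.

(** Conservation of mass for a martingale on the tree. It gives total mass 1 to the probability
    weights on strings and to [beta_weight]. *)
Lemma tree_sum_harmonic n G : (forall s, G (true :: s) + G (false :: s) = G s) ->
  tree_sum n G = G [::].
Proof.
move=> GS; elim: n => [//|n IH] /=; rewrite -IH.
by apply: eq_tree_sum => s _.
Qed.

End TreeSums.

(** * Sign strings and the verdict of a test *)

Section SignStrings.
Context {R : realType}.
Implicit Types (gamma th : R) (y : nat -> R) (s : seq bool) (b up : bool).

(** With the latest sign in front, the suffixes of a string are the earlier states of the walk, so
    recursion on the list goes back in time. *)
Fixpoint sign_string n y : seq bool :=
  if n is n'.+1 then (0 <= y n') :: sign_string n' y else [::].

Lemma size_sign_string n y : size (sign_string n y) = n.
Proof. by elim: n => //= n ->. Qed.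

Definition tally_diff s : R := (count id s)%:R - (count negb s)%:R.

Lemma tally_diff_cons b s :
  tally_diff (b :: s) = (if b then 1 else -1) + tally_diff s.
Proof. by rewrite /tally_diff; case: b => /=; rewrite ?add0n natrD; lra. Qed.

Lemma walkE n y : walk y n = tally_diff (sign_string n y).
Proof.
elim: n => [|n IH]; first by rewrite /walk big_ord0 /tally_diff subrr.
rewrite /= tally_diff_cons -IH /walk big_ord_recr /= addrC.
by congr (_ + _); rewrite /ztilde; case: (0 <= y n).
Qed.

Lemma tally_diff_flip s : tally_diff (map negb s) = - tally_diff s.
Proof.
elim: s => [|b s IH]; first by rewrite /tally_diff subrr oppr0.
by rewrite /= !tally_diff_cons IH; case: b; rewrite /=; lra.
Qed.

Definition exits_string gamma s : bool :=
  (1 <= size s)%N && (boundary gamma (size s) <= `|tally_diff s|).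

Lemma exitsE gamma y n : exits gamma y n = exits_string gamma (sign_string n y).
Proof. by rewrite /exits /exits_string size_sign_string walkE. Qed.

(* Decision of the first exit, if any, among the nonempty suffixes of s. *)
Fixpoint verdict gamma s : option bool :=
  if s is b :: s' then
    if verdict gamma s' is Some v then Some v
    else if exits_string gamma s then Some (0 < tally_diff s) else None
  else None.

Lemma verdict_sign_string_stop gamma y n :
  (forall m, (m < n)%N -> ~~ exits gamma y m) -> exits gamma y n ->
  verdict gamma (sign_string n y) = Some (0 < walk y n).
Proof.
case: n => [|n] noexit; first by rewrite /exits.
move=> ex; have none m : (m <= n)%N -> verdict gamma (sign_string m y) = None.
  elim: m => [//|m IH] mn; rewrite /= IH ?(ltnW mn) //.
  by have := noexit m.+1 mn; rewrite exitsE => /negbTE ->.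
by move: ex; rewrite exitsE walkE /= none // => ->.
Qed.

Lemma verdict_sign_string_None gamma y n :
  (forall m, (m <= n)%N -> ~~ exits gamma y m) <->
  verdict gamma (sign_string n y) = None.
Proof.
elim: n => [|n IH].
  by split=> // _ m; rewrite leqn0 => /eqP ->; rewrite /exits.
split=> [noexit|/=].
  rewrite /= (IH.1 _) => [|m mn]; last by apply: noexit; apply: leqW.
  by have := noexit n.+1 (leqnn _); rewrite exitsE => /negbTE ->.
case E: (verdict gamma (sign_string n y)) => //.
case: ifP => // ex _ m; rewrite leq_eqVlt => /orP[/eqP ->|].
  by rewrite exitsE ex.
by rewrite ltnS; apply: (IH.2 E).
Qed.

Lemma verdict_sign_string_ge gamma y m n v : (m <= n)%N ->
  verdict gamma (sign_string m y) = Some v ->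
  verdict gamma (sign_string n y) = Some v.
Proof.
move=> /subnKC <- vm; elim: (n - m)%N => [|k IH]; first by rewrite addn0.
by rewrite addnS /= IH.
Qed.

Lemma boundary_gt0 gamma m : 0 < gamma < 1 -> (0 < m)%N -> 0 < boundary gamma m.
Proof.
move=> /andP[g0 g1] m0; rewrite sqrtr_gt0 !mulr_gt0 ?ltr0n // subr_gt0.
by rewrite ltr_ln ?posrE ?ltr0n // (lt_le_trans g1) // ler1n.
Qed.

Lemma test_signE gamma y n : 0 < gamma < 1 -> exits gamma y n ->
  verdict gamma (sign_string n y) = Some (test_sign gamma y).
Proof.
move=> g01 ex; rewrite /test_sign /stop_time; case: pselect => [h|]; last first.
  by case; exists n.
case: ex_minnP => m exm mmin; apply: (@verdict_sign_string_ge _ _ m).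
  exact: mmin.
apply: verdict_sign_string_stop => // k km; apply/negP => /mmin.
by rewrite leqNgt km.
Qed.

Lemma verdict_test_sign gamma y n v : 0 < gamma < 1 ->
  verdict gamma (sign_string n y) = Some v -> test_sign gamma y = v.
Proof.
move=> g01 vn.
have [m mn ex] : exists2 m, (m <= n)%N & exits gamma y m.
  apply: contrapT => nex.
  suff /verdict_sign_string_None : forall m, (m <= n)%N -> ~~ exits gamma y m.
    by rewrite vn.
  by move=> m mn; apply/negP => ex; apply: nex; exists m.
have := verdict_sign_string_ge mn (test_signE g01 ex).
by rewrite vn => -[].
Qed.

(** The verdict is the strict test [0 < tally_diff s], which is antisymmetric only off zero; the
    positive boundary excludes a zero tally at an exit. *)
Lemma verdict_flip gamma s : 0 < gamma < 1 ->
  verdict gamma (map negb s) = omap negb (verdict gamma s).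
Proof.
move=> g01; elim: s => [//|b s IH] /=; rewrite IH.
case: (verdict gamma s) => //=.
rewrite /exits_string /= size_map -!map_cons tally_diff_flip normrN.
case: ifP => //= bd; congr Some.
have: 0 < `|tally_diff (b :: s)| by apply: lt_le_trans bd; apply: boundary_gt0.
rewrite normr_gt0 oppr_gt0 => nz.
by rewrite -real_leNgt ?num_real // le_eqVlt (negbTE nz).
Qed.

End SignStrings.

(** * The power-one test *)

(** Comparison of power series term by term: odd terms cancel, and x^(2N) / (2N)! is at most (x^2 /
    2)^N / N! because 2^N N! <= (2N)!. *)
Lemma cosh_le_exp_sqr {R : realType} (x : R) :
  expR x + expR (- x) <= 2 * expR (x ^+ 2 / 2).
Proof.
have even_part N :
    \sum_(0 <= i < N.*2) exp_coeff x i + \sum_(0 <= i < N.*2) exp_coeff (- x) i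
    <= 2 * \sum_(0 <= i < N) exp_coeff (x ^+ 2 / 2) i.
  elim: N => [|N IH]; first by rewrite !big_nil; lra.
  rewrite doubleS !big_nat_recr //= mulrDr.
  have odd_term : exp_coeff x N.*2.+1 + exp_coeff (- x) N.*2.+1 = 0.
    by rewrite /exp_coeff /= exprNn -signr_odd /= odd_double expr1; lra.
  have even_term : exp_coeff (- x) N.*2 = exp_coeff x N.*2.
    by rewrite /exp_coeff /= exprNn -signr_odd /= odd_double expr0 mul1r.
  suff : exp_coeff x N.*2 <= exp_coeff (x ^+ 2 / 2) N by lra.
  rewrite /exp_coeff /= expr_div_n -exprM mul2n -mulrA ler_wpM2l //.
    by rewrite -mul2n exprM exprn_ge0 // sqr_ge0.
  rewrite -invfM lef_pV2 ?posrE ?mulr_gt0 ?exprn_gt0 ?ltr0n ?fact_gt0 //.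
  rewrite -natrX -natrM ler_nat.
  elim: N {IH odd_term even_term} => [//|N IH].
  rewrite doubleS !factS expnS.
  have -> : (2 * 2 ^ N * (N.+1 * N`!) = N.*2.+2 * (2 ^ N * N`!))%N.
    by rewrite -doubleS -mul2n; ring.
  by rewrite leq_mul // (leq_trans IH) // leq_pmull.
have sub2 : double @ \oo --> \oo.
  have -> : double = muln 2 by apply/funext => n; rewrite mul2n.
  exact: cvg_mulnl.
have cvg2 (y : R) : \sum_(0 <= i < N.*2) (exp_coeff y i : R) @[N --> \oo] --> expR y.
  exact: (cvg_comp _ _ sub2 (is_cvg_series_exp_coeff y)).
have L := cvgD (cvg2 x) (cvg2 (- x)).
have U := cvgM (cvg_cst (2 : R)) (is_cvg_series_exp_coeff (x ^+ 2 / 2)).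
apply: (ler_cvg_to (L _) (U _ _)); apply: nearW => N; exact: even_part.
Qed.

(** Chernoff's argument: one term of the binomial expansion of (e^l + e^(-l))^m is at most the
    whole, hence at most 2^m e^(m l^2 / 2); l = (r - c) / m is the optimal choice. *)
Lemma binomial_tail {R : realType} (m c r : nat) : (0 < m)%N -> (c + r = m)%N ->
  ('C(m, c))%:R / 2 ^+ m <= expR (- ((r%:R - c%:R) ^+ 2 / (2 * m%:R))) :> R.
Proof.
move=> m0 crm.
pose l : R := (r%:R - c%:R) / m%:R.
have mR : (m%:R : R) != 0 by rewrite pnatr_eq0 -lt0n.
rewrite ler_pdivrMr ?exprn_gt0 //.
have cm : (c < m.+1)%N by rewrite ltnS -crm leq_addr.
have : 'C(m, c)%:R * expR (l * (r%:R - c%:R)) <= (expR l + expR (- l)) ^+ m.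
  rewrite exprDn (bigD1 (Ordinal cm)) //= -[leLHS]addr0 lerD //.
    rewrite /= -[leRHS]mulr_natl ler_wpM2l ?ler0n // le_eqVlt; apply/orP; left; apply/eqP.
    have -> : (m - c = r)%N by rewrite -crm addKn.
    by rewrite -!expRM_natl -expRD; congr expR; lra.
  by apply: sumr_ge0 => i _; rewrite mulrn_wge0 // mulr_ge0 // exprn_ge0 // expR_ge0.
move=> /le_trans -/(_ ((2 * expR (l ^+ 2 / 2)) ^+ m)) H.
have {}H : 'C(m, c)%:R * expR (l * (r%:R - c%:R)) <= 2 ^+ m * expR (l ^+ 2 / 2 * m%:R).
  rewrite expRM_natr -exprMn; apply: H; apply: lerXn2r.
  - by rewrite nnegrE addr_ge0 // expR_ge0.
  - by rewrite nnegrE mulr_ge0 // expR_ge0.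
  - exact: cosh_le_exp_sqr.
rewrite -(ler_pM2r (expR_gt0 (l * (r%:R - c%:R)))); apply: le_trans H _.
rewrite [leRHS]mulrAC -expRD [leRHS]mulrC ler_wpM2l ?exprn_ge0 // ler_expR.
by rewrite /l le_eqVlt; apply/orP; left; apply/eqP; field.
Qed.

Section TestEstimates.
Context {R : realType}.
Implicit Types (gamma th : R) (s : seq bool) (m n : nat).

Definition bernoulli_weight th s : R :=
  th ^+ count id s * (1 - th) ^+ count negb s.

Lemma bernoulli_weight_cons th b s : bernoulli_weight th (b :: s) =
  (if b then th else 1 - th) * bernoulli_weight th s.
Proof.
by rewrite /bernoulli_weight; case: b => /=; rewrite add1n add0n exprS; ring.
Qed.

Lemma bernoulli_weight_ge0 th s : 0 <= th <= 1 -> 0 <= bernoulli_weight th s.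
Proof. by move=> /andP[? ?]; rewrite mulr_ge0 // exprn_ge0 ?subr_ge0. Qed.

Lemma tree_sum_bernoulli_weight th n : tree_sum n (bernoulli_weight th) = 1.
Proof.
rewrite tree_sum_harmonic => [|s]; first by rewrite /bernoulli_weight mulr1.
by rewrite !bernoulli_weight_cons; lra.
Qed.

(** A sign has mean 2 th - 1 and variance 4 th (1 - th), and the cross term vanishes on averaging
    over the last sign. *)
Lemma tree_sum_walk_variance th n :
  tree_sum n (fun s => bernoulli_weight th s
    * (tally_diff s - n%:R * (2 * th - 1)) ^+ 2) = n%:R * (4 * th * (1 - th)).
Proof.
elim: n => [|n IH].
  by rewrite /= /tally_diff /bernoulli_weight /=; ring.
have -> : n.+1%:R * (4 * th * (1 - th)) = n%:R * (4 * th * (1 - th))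
    + 4 * th * (1 - th) * tree_sum n (bernoulli_weight th).
  by rewrite tree_sum_bernoulli_weight -natr1; ring.
rewrite /= -IH -tree_sumZ -tree_sumD; apply: eq_tree_sum => s _.
by rewrite !bernoulli_weight_cons !tally_diff_cons -natr1; ring.
Qed.

(** Chebyshev's inequality: when the tally is below k in modulus, it misses its mean by at least n
    |2 th - 1| - k, while its variance is at most n. *)
Lemma tree_sum_walk_small th n (k : R) : 0 <= th <= 1 ->
  k <= n%:R * `|2 * th - 1| ->
  (n%:R * `|2 * th - 1| - k) ^+ 2 *
    tree_sum n (fun s => (`|tally_diff s : R| < k)%R%:R * bernoulli_weight th s)
  <= n%:R.
Proof.
move=> /andP[th0 th1] kn.
apply: (@le_trans _ _ (n%:R * (4 * th * (1 - th)))); last first.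
  rewrite -[leRHS]mulr1 ler_wpM2l //.
  by have := sqr_ge0 (2 * th - 1); nra.
rewrite -tree_sum_walk_variance -tree_sumZ; apply: ler_tree_sum => s _.
rewrite mulrCA [leRHS]mulrC mulrA ler_wpM2r ?bernoulli_weight_ge0 ?th0 //.
case: ltP => [Sk|_]; last by rewrite mul0r sqr_ge0.
rewrite mul1r -[leRHS]real_normK ?num_real //; apply: lerXn2r.
- by rewrite nnegrE subr_ge0.
- by rewrite nnegrE.
- rewrite [leRHS]distrC; apply: (le_trans _ (lerB_dist _ _)).
  by rewrite normrM normr_nat lerD2l lerN2 ltW.
Qed.

(* Integral of [bernoulli_weight] against the uniform prior on th; being a
   mixture of martingales it is a martingale itself. *)
Definition beta_weight s : R :=
  (count id s)`!%:R * (count negb s)`!%:R / (size s).+1`!%:R.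

Lemma beta_weight_harmonic s :
  beta_weight (true :: s) + beta_weight (false :: s) = beta_weight s.
Proof.
rewrite /beta_weight /= !add1n !add0n -(count_predC id s) -/(predC id).
have -> : count (predC id) s = count negb s by [].
move: (count id s) (count negb s) => c r.
rewrite !factS !natrM.
have c0 := ler0n R c; have r0 := ler0n R r.
by field; rewrite pnatr_eq0 -lt0n fact_gt0 /=; apply/andP; split; lra.
Qed.

(* At a wrong exit the likelihood is at most 2^-m, and the boundary is such that
   Chernoff's bound gives 'C(m, c) 2^-m <= gamma / (m + 1). *)
Lemma bernoulli_weight_wrong_exit gamma th s : 0 < gamma < 1 -> 2^-1 <= th <= 1 ->
  exits_string gamma s -> tally_diff s < 0 :> R ->
  bernoulli_weight th s <= gamma * beta_weight s.
Proof.
move=> g01 /andP[th2 th1] /andP[s0 bd] neg.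
have g0 : 0 < gamma by case/andP: g01.
have sz : (count id s + count negb s = size s)%N by rewrite -(count_predC id s).
have cr : (count id s <= count negb s)%N.
  by move: neg; rewrite subr_lt0 ltr_nat => /ltnW.
apply: (@le_trans _ _ ((2 ^+ size s)^-1)).
  (* Each plus sign is paired with a minus sign, which costs th (1 - th) <= 1/4; the unpaired minus
     signs cost 1 - th <= 1/2 each. *)
  rewrite /bernoulli_weight -sz -{1}(subnKC cr) exprD mulrA -exprMn.
  have -> : (2 ^+ (count id s + count negb s))^-1 =
      (4^-1) ^+ (count id s) * (2^-1) ^+ (count negb s - count id s) :> R.
    rewrite !exprVn -invfM; congr (_^-1).
    have -> : 4 = 2 ^+ 2 :> R by rewrite expr2; ring.
    by rewrite -exprM -exprD; congr (_ ^+ _); rewrite mul2n -addnn -addnA subnKC.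
  apply: ler_pM; rewrite ?exprn_ge0 ?mulr_ge0 //; try lra.
    by apply: lerXn2r; rewrite ?nnegrE; nra.
  by apply: lerXn2r; rewrite ?nnegrE; lra.
have := @binomial_tail R (size s) (count id s) (count negb s) s0 sz.
have sR : 0 < (size s)%:R :> R by rewrite ltr0n.
(* The squared boundary divided by 2m is exactly ln (m + 1) - ln gamma, which turns the Chernoff
   exponent into gamma / (m + 1). *)
have L : ln (size s).+1%:R - ln gamma <=
    ((count negb s)%:R - (count id s)%:R) ^+ 2 / (2 * (size s)%:R) :> R.
  have -> : ((count negb s)%:R - (count id s)%:R) ^+ 2 = `|tally_diff s| ^+ 2 :> R.
    by rewrite real_normK ?num_real // -sqrrN opprB.
  rewrite ler_pdivlMr ?mulr_gt0 // mulrC.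
  have := boundary_gt0 g01 s0; rewrite /boundary sqrtr_gt0 => /ltW/sqr_sqrtr <-.
  by apply: lerXn2r bd; rewrite nnegrE ?sqrtr_ge0.
have : expR (- (((count negb s)%:R - (count id s)%:R) ^+ 2 / (2 * (size s)%:R)))
    <= gamma / (size s).+1%:R.
  rewrite -[gamma in leRHS]lnK ?posrE // -[in leRHS](@lnK _ (size s).+1%:R) ?posrE //.
  rewrite -expRN -expRD ler_expR; lra.
move=> /[swap] /le_trans /[apply] H.
have M0 n : 0 < n`!%:R :> R by rewrite ltr0n fact_gt0.
have cle : (count id s <= size s)%N by rewrite -sz leq_addr.
have BF : 'C(size s, count id s)%:R * ((count id s)`!%:R * (count negb s)`!%:R)
    = (size s)`!%:R :> R.
  by rewrite -!natrM -(bin_fact cle) -{3}sz addKn.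
rewrite /beta_weight factS natrM mulrA ler_pdivlMr ?mulr_gt0 //.
rewrite -BF.
rewrite ler_pdivlMr ?ltr0n // in H.
have {}H := ler_wpM2r (ltW (mulr_gt0 (M0 (count id s)) (M0 (count negb s)))) H.
lra.
Qed.

Definition verdict_is gamma v s : R := (verdict gamma s == Some v)%:R.

(** Optional stopping: after the verdict, [G] is summed over all continuations and keeps its value,
    so the sum changes only at first exits with verdict v, where [G] is nonnegative. *)
Lemma tree_sum_verdict_ge0 gamma v (G : seq bool -> R) n :
  (forall s, G (true :: s) + G (false :: s) = G s) ->
  (forall b s, verdict gamma s = None -> verdict gamma (b :: s) = Some v ->
     0 <= G (b :: s)) ->
  0 <= tree_sum n (fun s => verdict_is gamma v s * G s).
Proof.
move=> GS Gex; elim: n => [|n IH]; first by rewrite /verdict_is /= mul0r.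
apply: le_trans IH _ => /=; apply: ler_tree_sum => s _.
rewrite /verdict_is; case E: (verdict gamma s) => [u|] /=.
  by rewrite E -mulrDr GS.
rewrite mul0r addr_ge0 //.
all: rewrite E; case: ifP => ex; rewrite ?mul0r //.
  case: eqP => ev; rewrite ?mul0r // mul1r; apply: Gex => //=.
  by rewrite E ex ev.
case: eqP => ev; rewrite ?mul0r // mul1r; apply: Gex => //=.
by rewrite E ex ev.
Qed.

(* Under [beta_weight] both verdicts are equally likely. *)
Lemma tree_sum_verdict_beta gamma n : 0 < gamma < 1 ->
  tree_sum n (fun s => verdict_is gamma false s * beta_weight s) <= 2^-1.
Proof.
move=> g01; set A := tree_sum n _.
have flip : tree_sum n (fun s => verdict_is gamma true s * beta_weight s) = A.
  rewrite /A -tree_sum_flip; apply: eq_tree_sum => s _ /=.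
  congr (_ * _).
    by rewrite /verdict_is verdict_flip //; case: (verdict gamma s) => [[]|].
  rewrite /beta_weight size_map !count_map; congr (_ / _); rewrite mulrC.
  by congr (_`!%:R * _`!%:R); apply: eq_count => -[].
suff : A + A <= 1 by lra.
rewrite -{1}flip -tree_sumD.
have <- : tree_sum n beta_weight = 1.
  by rewrite tree_sum_harmonic ?/beta_weight /= ?mulr1 ?divr1 //; exact: beta_weight_harmonic.
apply: ler_tree_sum => s _; rewrite -mulrDl ler_piMl //.
  by rewrite /beta_weight !mulr_ge0 // invr_ge0.
by rewrite /verdict_is; case: (verdict gamma s) => [[]|] /=; rewrite ?addr0 ?add0r.
Qed.

(** Exchanging the signs reduces to v = false. There the martingale gamma * [beta_weight] -
    [bernoulli_weight] is nonnegative at every exit with that verdict, and the mixture gives the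
    verdict mass at most 1/2, whence gamma / 2. *)
Lemma tree_sum_verdict_wrong gamma th v n : 0 < gamma < 1 -> 0 <= th <= 1 ->
  (if v then th <= 2^-1 else 2^-1 <= th) ->
  tree_sum n (fun s => verdict_is gamma v s * bernoulli_weight th s) <= gamma / 2.
Proof.
move=> g01; wlog vF : v th / v = false => [H|].
  case: v => thb th2; last by rewrite H.
  rewrite -tree_sum_flip.
  have -> : tree_sum n ((fun s => verdict_is gamma true s * bernoulli_weight th s)
      \o map negb) =
      tree_sum n (fun s => verdict_is gamma false s * bernoulli_weight (1 - th) s).
    apply: eq_tree_sum => s _ /=; congr (_ * _).
      by rewrite /verdict_is verdict_flip //; case: (verdict gamma s) => [[]|].
    rewrite /bernoulli_weight !count_map mulrC subKr.
    by congr (_ ^+ _ * _ ^+ _); apply: eq_count => -[].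
  by apply: H => //; lra.
rewrite vF => /andP[_ th1] th2.
have g0 : 0 < gamma by case/andP: g01.
have := @tree_sum_verdict_ge0 gamma false
  (fun s => gamma * beta_weight s - bernoulli_weight th s) n.
have -> : tree_sum n (fun s => verdict_is gamma false s
      * (gamma * beta_weight s - bernoulli_weight th s)) =
    gamma * tree_sum n (fun s => verdict_is gamma false s * beta_weight s)
    - tree_sum n (fun s => verdict_is gamma false s * bernoulli_weight th s).
  rewrite -[X in _ - X]mul1r -mulNr -!tree_sumZ -tree_sumD.
  by apply: eq_tree_sum => s _; ring.
move=> H; have := tree_sum_verdict_beta n g01.
rewrite -(ler_pM2l g0) => B.
suff: 0 <= gamma * tree_sum n (fun s => verdict_is gamma false s * beta_weight s)
    - tree_sum n (fun s => verdict_is gamma false s * bernoulli_weight th s) by lra.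
apply: H => [s|b s vN]; first by rewrite -(beta_weight_harmonic s) !bernoulli_weight_cons; lra.
rewrite /= vN; case: ifP => // ex [] S0; rewrite subr_ge0.
apply: bernoulli_weight_wrong_exit => //; first by rewrite th2 th1.
have : 0 < `|tally_diff (b :: s) : R|.
  by case/andP: ex => sz; apply: lt_le_trans; apply: boundary_gt0.
rewrite normr_gt0 => nz; rewrite lt_neqAle nz /=.
by rewrite leNgt S0.
Qed.

End TestEstimates.

(** * Drift of the bisection *)

Section Bisection.
Context {R : realType}.
Implicit Types (p u v x : R) (z : seq bool) (b : bool).

(* How the test result b changes the value u of the posterior distribution
   function at a fixed point; the median is to the left of it iff u > 1/2. *)
Definition bisect p b u : R :=
  let a := if b then p else 1 - p in
  if u <= 2^-1 then 2 * (1 - a) * u else 1 - 2 * a * (1 - u).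

(** Carries the estimates from one side of the root to the other. The branches overlap under
    reflection only at u = 1/2, where both formulas give 1 - a. *)
Lemma bisect_opp p b u : 1 - bisect p b u = bisect p (~~ b) (1 - u).
Proof.
rewrite /bisect; case: b; case: (lerP u 2^-1) => h1;
  case: (lerP (1 - u) 2^-1) => h2 /=; try lra.
all: by (have -> : u = 2^-1 by lra); lra.
Qed.

Lemma bisect_mono p b u v : 0 < p < 1 -> u < v -> bisect p b u < bisect p b v.
Proof.
move=> /andP[p0 p1] uv; rewrite /bisect.
by case: b; case: (lerP u 2^-1) => h1; case: (lerP v 2^-1) => h2 /=; nra.
Qed.

Lemma bisect0 p b : bisect p b 0 = 0.
Proof. by rewrite /bisect invr_ge0 ler0n mulr0. Qed.

Lemma bisect1 p b : bisect p b 1 = 1.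
Proof. by rewrite /bisect ifF ?subrr ?mulr0 ?subr0 //; apply/negbTE; lra. Qed.

(** The uniform prior has distribution function x on [0, 1], and [foldr] applies the oldest result
    first. The analysis of the bisection needs only this function; densities are tied to it by
    [posterior_densityP]. *)
Definition posterior_cdf p z x : R := foldr (bisect p) x z.

Lemma posterior_cdf_mono p z x y : 0 < p < 1 -> x < y ->
  posterior_cdf p z x < posterior_cdf p z y.
Proof. by move=> p01 xy; elim: z => //= b z; apply: bisect_mono. Qed.

Lemma posterior_cdf0 p z : posterior_cdf p z 0 = 0.
Proof. by elim: z => //= b z ->; rewrite bisect0. Qed.

Lemma posterior_cdf1 p z : posterior_cdf p z 1 = 1.
Proof. by elim: z => //= b z ->; rewrite bisect1. Qed.

Lemma posterior_cdf_itv p z x : 0 < p < 1 -> 0 <= x <= 1 ->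
  0 <= posterior_cdf p z x <= 1.
Proof.
move=> p01 /andP[]; rewrite !le_eqVlt => /orP[/eqP <-|x0] /orP[/eqP x1|x1].
- by move/eqP: x1; rewrite eq_sym oner_eq0.
- by rewrite posterior_cdf0 eqxx ltr01 orbT.
- by rewrite x1 posterior_cdf1 eqxx ltr01 orbT.
- have := posterior_cdf_mono z p01 x0; have := posterior_cdf_mono z p01 x1.
  by rewrite posterior_cdf0 posterior_cdf1 => -> ->; rewrite !orbT.
Qed.

(* Minus the logarithm of the mass of ]xstar, xstar + h] relative to that of ]xstar, 1],
   u and v being the values of the distribution function at xstar and xstar + h. *)
Definition potential u v : R := ln ((1 - u) / (v - u)).

Lemma ln_sub_ge (x y : R) : 0 < x -> 0 < y -> 1 - y / x <= ln x - ln y.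
Proof.
move=> x0 y0; rewrite -opprB -[leRHS]opprB lerN2 -ln_div ?posrE //.
have := @le_ln1Dx R (y / x - 1); rewrite subrKC; apply.
by rewrite ltrBrDl subrr divr_gt0.
Qed.

Lemma potential_ge0 u v : u < v -> v <= 1 -> 0 <= potential u v.
Proof.
move=> uv v1; rewrite ln_ge0 // ler_pdivlMr ?subr_gt0 //; lra.
Qed.

(** [LT] and [LF] are the losses of potential after the results true and false. With w = wt + wf,
    the right side is w (p LF + (1 - p) LT) + ((1 - p) w - wt) (LF - LT), and (1 - p) w - wt >= (1 -
    a - p) w. *)
Lemma bisect_drift_arith (p a wt wf LT LF dl : R) : 0 <= wt -> 0 <= wf -> p <= 1 - a ->
  wt <= a * (wt + wf) -> 0 <= p * LF + (1 - p) * LT -> 0 <= dl -> dl <= LF - LT ->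
  (wt + wf) * ((1 - a - p) * dl) <= wt * LT + wf * LF.
Proof.
move=> wt0 wf0 pa wta H dl0 dlL.
have h1 : 0 <= (a * (wt + wf) - wt) * (LF - LT) by rewrite mulr_ge0 //; lra.
have h2 : 0 <= (wt + wf) * (p * LF + (1 - p) * LT) by rewrite mulr_ge0 //; lra.
have h3 : 0 <= (wt + wf) * ((1 - a - p) * (LF - LT - dl)).
  by rewrite !mulr_ge0 //; lra.
nra.
Qed.

(* With weights p and 1 - p instead of 1 - a and a the potential would be a
   supermartingale, by ln y >= 1 - 1/y; the surplus 1 - a - p of correct answers
   then gains the gap between the two logarithms, at least ln p - ln (1 - p) when
   the median is to the right of xstar + h. *)
Lemma bisect_drift (p a wt wf u v : R) : 2^-1 < p -> p <= 1 - a -> 0 < a ->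
  0 <= u -> u < v -> v <= 1 ->
  0 <= wt -> 0 <= wf ->
  (u < 2^-1 -> wt <= a * (wt + wf)) -> (u = 2^-1 -> wt + wf = 0) ->
  wt * potential (bisect p true u) (bisect p true v)
  + wf * potential (bisect p false u) (bisect p false v)
  <= (wt + wf) * (potential u v - (1 - a - p) * (ln p - ln (1 - p)) * (v < 2^-1)%R%:R).
Proof.
move=> p2 pa a0 u0 uv v1 wt0 wf0 wta wu.
have [p0 q0] : 0 < p /\ 0 < 1 - p by split; lra.
have [u2|u2|u2] := ltgtP u 2^-1; last first.
- have {}wu := wu u2; have -> : wt = 0 by lra.
  by have -> : wf = 0; lra.
(* The median lies to the left of both points, so the two masses in the potential are scaled by the
   same factor and their ratio is unchanged. *)
- have v2 : 2^-1 < v by lra.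
  rewrite /bisect (leNgt u) u2 (leNgt v) v2 (ltNge v) (ltW v2) /= mulr0 subr0.
  have ratio t : 0 < t -> potential (1 - 2 * t * (1 - u)) (1 - 2 * t * (1 - v)) = potential u v.
    move=> t0; rewrite /potential; congr ln; field.
    by apply/andP; split; apply: lt0r_neq0; nra.
  by rewrite !ratio // mulrDl.
have [ps psD] : exists x, x = (1 - u) / (v - u) by eexists.
have [pF pFD] : exists x, x = (1 - bisect p false u) / (bisect p false v - bisect p false u)
  by eexists.
have [pT pTD] : exists x, x = (1 - bisect p true u) / (bisect p true v - bisect p true u)
  by eexists.
have ps0 : 0 < ps by rewrite psD divr_gt0 //; lra.
have p01 : 0 < p < 1 by lra.
have pos b : 0 < (1 - bisect p b u) / (bisect p b v - bisect p b u).
  rewrite divr_gt0 ?subr_gt0 ?bisect_mono // -[ltRHS](bisect1 p b) bisect_mono //; lra.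
have pF0 : 0 < pF by rewrite pFD.
have pT0 : 0 < pT by rewrite pTD.
have [avg gap] : p * pF + (1 - p) * pT <= ps /\
    (ln p - ln (1 - p)) * (v < 2^-1)%R%:R <= ln pT - ln pF.
  (* For v < 1/2 the mass v - u is multiplied by a single factor, and [avg] is an equality;
     otherwise the median cuts it into two pieces. *)
  have [v2|v2] := ltrP v 2^-1.
    have pFE : pF = (1 - 2 * p * u) / (2 * p * (v - u)).
      by rewrite pFD /bisect /= (ltW u2) (ltW v2) -mulrBr; congr (_ / _); ring.
    have pTE : pT = (1 - 2 * (1 - p) * u) / (2 * (1 - p) * (v - u)).
      by rewrite pTD /bisect /= (ltW u2) (ltW v2) -mulrBr.
    split.
      rewrite le_eqVlt; apply/orP; left; apply/eqP.
      by rewrite pFE pTE psD; field; do ?[apply/andP; split]; apply: lt0r_neq0; lra.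
    rewrite mulr1; suff : ln (p * pF) <= ln ((1 - p) * pT).
      by rewrite !lnM ?posrE //; lra.
    rewrite ler_ln ?posrE ?mulr_gt0 // pFE pTE.
    have -> : p * ((1 - 2 * p * u) / (2 * p * (v - u))) = (1 - 2 * p * u) / (2 * (v - u)).
      by field; do ?[apply/andP; split]; apply: lt0r_neq0; lra.
    have -> : (1 - p) * ((1 - 2 * (1 - p) * u) / (2 * (1 - p) * (v - u))) =
        (1 - 2 * (1 - p) * u) / (2 * (v - u)).
      by field; do ?[apply/andP; split]; apply: lt0r_neq0; lra.
    rewrite ler_wpM2r ?invr_ge0 //; [lra|nra].
  have bv b : bisect p b v = 1 - 2 * (if b then p else 1 - p) * (1 - v).
    rewrite /bisect; case: lerP => // vle; have -> : v = 2^-1 by lra.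
    by case: b; field.
  (* In terms of the pieces on either side of the median, the deficit in [avg] is a fraction whose
     factors all have a visible sign. *)
  pose A := 2^-1 - u; pose E := v - 2^-1.
  have A0 : 0 < A by rewrite /A; lra.
  have E0 : 0 <= E by rewrite /E; lra.
  have E1 : 0 <= 1 - 2 * E by rewrite /E; lra.
  have psE : ps = (2^-1 + A) / (A + E) by rewrite psD /A /E; congr (_ / _); lra.
  have pFE : pF = (1 - p + 2 * p * A) / (2 * (p * A + (1 - p) * E)).
    by rewrite pFD bv /bisect /= (ltW u2) /A /E; congr (_ / _); field.
  have pTE : pT = (p + 2 * (1 - p) * A) / (2 * ((1 - p) * A + p * E)).
    by rewrite pTD bv /bisect /= (ltW u2) /A /E; congr (_ / _); field.
  have d1 : 0 < p * A + (1 - p) * E by rewrite ltr_pwDl ?mulr_gt0 ?mulr_ge0 // ltW.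
  have d2 : 0 < (1 - p) * A + p * E by rewrite ltr_pwDl ?mulr_gt0 ?mulr_ge0 // ltW.
  clearbody A E; split.
    rewrite pFE pTE psE -subr_ge0.
    have -> : (2^-1 + A) / (A + E) -
      (p * ((1 - p + 2 * p * A) / (2 * (p * A + (1 - p) * E))) +
       (1 - p) * ((p + 2 * (1 - p) * A) / (2 * ((1 - p) * A + p * E)))) =
      (1 - 2 * E) * A * E * (2 * p - 1) ^+ 2 /
        (2 * (A + E) * (p * A + (1 - p) * E) * ((1 - p) * A + p * E)).
      by field; do ?[apply/andP; split]; apply: lt0r_neq0; lra.
    apply: divr_ge0; last by rewrite !mulr_ge0 ?(ltW d1) ?(ltW d2) //; lra.
    by rewrite mulr_ge0 ?sqr_ge0 // mulr_ge0 // mulr_ge0 // ltW.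
  rewrite mulr0 subr_ge0 ler_ln ?posrE // pFE pTE.
  rewrite ler_pdivrMr ?mulr_gt0 // [leRHS]mulrAC ler_pdivlMr ?mulr_gt0 //.
  rewrite -subr_ge0; set lhs := (X in 0 <= X).
  have -> : lhs = 2 * A * (2 * p - 1) * (1 - 2 * E) by rewrite /lhs; ring.
  by rewrite !mulr_ge0 ?ler0n ?(ltW A0) //; lra.
have -> : potential u v = ln ps by rewrite psD.
have -> : potential (bisect p true u) (bisect p true v) = ln pT by rewrite pTD.
have -> : potential (bisect p false u) (bisect p false v) = ln pF by rewrite pFD.
set dl := _ * _ in gap.
have h1 : 0 <= p * (ln ps - ln pF) + (1 - p) * (ln ps - ln pT).
  have := ler_wpM2l (ltW p0) (ln_sub_ge ps0 pF0).
  have := ler_wpM2l (ltW q0) (ln_sub_ge ps0 pT0).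
  have : p * (pF / ps) + (1 - p) * (pT / ps) <= 1.
    by rewrite !mulrA -mulrDl ler_pdivrMr // mul1r.
  lra.
have h2 : 0 <= dl.
  by rewrite mulr_ge0 // subr_ge0 ler_ln ?posrE //; lra.
have h3 : dl <= ln ps - ln pF - (ln ps - ln pT) by lra.
have := bisect_drift_arith wt0 wf0 pa (wta u2) h1 h2 h3.
have -> : (1 - a - p) * (ln p - ln (1 - p)) * (v < 2^-1)%R%:R = (1 - a - p) * dl.
  by rewrite mulrA.
lra.
Qed.

End Bisection.

(** * Expected time away from the root *)

(** A Lyapunov function bounds occupation: each level loses c0 times the weight of [I], and the
    total loss cannot exceed the initial value. The induction carries along the potential still
    present at level n. *)
Lemma occupation_bound {R : realType} (pi B I : seq bool -> R) (c0 : R) :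
  (forall z, 0 <= pi z) -> (forall z, 0 <= B z) ->
  (forall z, pi (true :: z) * B (true :: z) + pi (false :: z) * B (false :: z)
     <= pi z * (B z - c0 * I z)) ->
  forall n, c0 * \sum_(m < n) tree_sum m (fun z => pi z * I z) <= pi [::] * B [::].
Proof.
move=> pi0 B0 drift n.
suff : c0 * \sum_(m < n) tree_sum m (fun z => pi z * I z)
    + tree_sum n (fun z => pi z * B z) <= pi [::] * B [::].
  apply: le_trans; rewrite lerDl tree_sum_ge0 // => z _; exact: mulr_ge0.
elim: n => [|n IH]; first by rewrite big_ord0 mulr0 add0r.
apply: le_trans IH; rewrite big_ord_recr /= mulrDr -addrA lerD2l.
rewrite -tree_sumZ -tree_sumD; apply: ler_tree_sum => z _.
have := drift z; lra.
Qed.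

(** * Moments of the distance to the root *)

Section MomentSum.
Context {R : realType}.
Variables (p a xs : R) (pi x : seq bool -> R).
Hypotheses (p2 : 2^-1 < p) (pa : p < 1 - a) (a0 : 0 < a) (xs01 : 0 <= xs <= 1).
Hypotheses (pi_ge0 : forall z, 0 <= pi z) (pi_nil : pi [::] = 1).
Hypothesis pi_split : forall z, pi (true :: z) + pi (false :: z) = pi z.
Hypothesis x01 : forall z, 0 <= x z <= 1.
Hypothesis x_median : forall z, posterior_cdf p z (x z) = 2^-1.
Hypothesis pi_right : forall z, xs < x z -> pi (true :: z) <= a * pi z.
Hypothesis pi_left : forall z, x z < xs -> pi (false :: z) <= a * pi z.
Hypothesis pi_star : forall z, x z = xs -> pi z = 0.

Let c0 := (1 - a - p) * (ln p - ln (1 - p)).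

Let p01 : 0 < p < 1.
Proof. by apply/andP; move: p2 pa a0 => *; split; lra. Qed.

Let cdf_lt_half z y : posterior_cdf p z y < 2^-1 -> y < x z.
Proof.
rewrite -(x_median z); case: (ltgtP y (x z)) => // [yx|->]; last by rewrite ltxx.
by move=> /lt_trans /(_ (posterior_cdf_mono z p01 yx)); rewrite ltxx.
Qed.

Let cdf_gt_half z y : 2^-1 < posterior_cdf p z y -> x z < y.
Proof.
rewrite -(x_median z); case: (ltgtP y (x z)) => // [yx|->]; last by rewrite ltxx.
by move=> /lt_trans /(_ (posterior_cdf_mono z p01 yx)); rewrite ltxx.
Qed.

(** The initial potential is ln ((1 - xs) / h) <= - ln h. By strict monotonicity the query point
    exceeds xs + h exactly when the cdf there is below 1/2, which is the case where [bisect_drift]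
    gains. *)
Lemma occupation_right (h : R) n : 0 < h -> h < 1 ->
  c0 * \sum_(m < n) tree_sum m (fun z => pi z * (xs + h < x z)%R%:R) <= - ln h.
Proof.
(* If xs + h exceeds 1, no query point lies beyond it and the sum is zero. *)
move=> h0 h1; have [xh|xh] := ltrP 1 (xs + h).
  rewrite big1 ?mulr0 ?oppr_ge0 ?ln_le0 ?ltW // => m _.
  transitivity (tree_sum m (fun z => 0 * pi z)); last by rewrite tree_sumZ mul0r.
  apply: eq_tree_sum => z _; rewrite mul0r ltNge.
  by rewrite (le_trans _ (ltW xh)) ?mulr0 //; case/andP: (x01 z).
pose u z := posterior_cdf p z xs; pose v z := posterior_cdf p z (xs + h).
have uv z : u z < v z by apply: (posterior_cdf_mono z p01); rewrite ltrDl.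
have u0 z : 0 <= u z by case/andP: (posterior_cdf_itv z p01 xs01).
have v1 z : v z <= 1.
  have /andP[//] : 0 <= v z <= 1.
  by apply: (posterior_cdf_itv z p01); rewrite xh andbT addr_ge0 ?(ltW h0) //; case/andP: xs01.
have half z : (xs + h < x z) = (v z < 2^-1).
  apply/idP/idP => [lt|/cdf_lt_half //].
  by rewrite -(x_median z) posterior_cdf_mono.
have drift z : pi (true :: z) * potential (u (true :: z)) (v (true :: z))
    + pi (false :: z) * potential (u (false :: z)) (v (false :: z))
    <= pi z * (potential (u z) (v z) - c0 * (xs + h < x z)%R%:R).
  rewrite half -(pi_split z) /c0; apply: (bisect_drift p2 (ltW pa)) => // [ult|ueq].
    by rewrite (pi_split z) pi_right //; apply: cdf_lt_half.
  have {}ueq : posterior_cdf p z xs = 2^-1 by exact: ueq.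
  rewrite (pi_split z) pi_star //; apply/eqP; rewrite eq_le !leNgt.
  by apply/andP; split; apply/negP => /(posterior_cdf_mono z p01);
    rewrite x_median => lt; lra.
apply: le_trans (occupation_bound pi_ge0 (fun z => potential_ge0 (uv z) (v1 z)) drift n) _.
rewrite pi_nil mul1r /potential /u /v /= -lnV ?posrE // ler_ln ?posrE ?invr_gt0 //.
  have -> : xs + h - xs = h by lra.
  rewrite -[leRHS]mul1r ler_wpM2r ?invr_ge0 ?(ltW h0) //.
  by case/andP: xs01 => *; lra.
by rewrite divr_gt0 //; lra.
Qed.

(* Reflection u -> 1 - u exchanges the two sides. *)
Lemma occupation_left (h : R) n : 0 < h -> h < 1 ->
  c0 * \sum_(m < n) tree_sum m (fun z => pi z * (x z < xs - h)%R%:R) <= - ln h.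
Proof.
move=> h0 h1; have [xh|xh] := ltrP (xs - h) 0.
  rewrite big1 ?mulr0 ?oppr_ge0 ?ln_le0 ?ltW // => m _.
  transitivity (tree_sum m (fun z => 0 * pi z)); last by rewrite tree_sumZ mul0r.
  apply: eq_tree_sum => z _; rewrite mul0r ltNge.
  by rewrite (le_trans (ltW xh)) ?mulr0 //; case/andP: (x01 z).
pose u z := 1 - posterior_cdf p z xs; pose v z := 1 - posterior_cdf p z (xs - h).
have uv z : u z < v z.
  by rewrite ltrD2l ltrN2; apply: (posterior_cdf_mono z p01); rewrite gtrBl.
have u0 z : 0 <= u z by rewrite subr_ge0; case/andP: (posterior_cdf_itv z p01 xs01).
have v1 z : v z <= 1.
  rewrite gerBl; have /andP[//] : 0 <= posterior_cdf p z (xs - h) <= 1.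
  apply: (posterior_cdf_itv z p01).
  by case/andP: xs01 => *; apply/andP; split; lra.
have half z : (x z < xs - h) = (v z < 2^-1).
  apply/idP/idP => [lt|vz]; last by apply: cdf_gt_half; rewrite /v in vz; lra.
  by have := posterior_cdf_mono z p01 lt; rewrite x_median /v; lra.
have uS b z : u (b :: z) = bisect p (~~ b) (u z) by rewrite /u /= bisect_opp.
have vS b z : v (b :: z) = bisect p (~~ b) (v z) by rewrite /v /= bisect_opp.
have drift z : pi (true :: z) * potential (u (true :: z)) (v (true :: z))
    + pi (false :: z) * potential (u (false :: z)) (v (false :: z))
    <= pi z * (potential (u z) (v z) - c0 * (x z < xs - h)%R%:R).
  rewrite half -(pi_split z) /c0 !uS !vS /= addrC [X in _ <= X * _]addrC.
  apply: (bisect_drift p2 (ltW pa)) => // [ult|ueq].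
    by rewrite addrC (pi_split z) pi_left //; apply: cdf_gt_half; rewrite /u in ult; lra.
  have {}ueq : posterior_cdf p z xs = 2^-1 by move: ueq; rewrite /u; lra.
  rewrite addrC (pi_split z) pi_star //; apply/eqP; rewrite eq_le !leNgt.
  by apply/andP; split; apply/negP => /(posterior_cdf_mono z p01);
    rewrite x_median => lt; lra.
apply: le_trans (occupation_bound pi_ge0 (fun z => potential_ge0 (uv z) (v1 z)) drift n) _.
rewrite pi_nil mul1r /potential /u /v /= -lnV ?posrE // ler_ln ?posrE ?invr_gt0 //.
  have -> : 1 - (1 - xs) = xs by lra.
  have -> : 1 - (xs - h) - (1 - xs) = h by lra.
  by rewrite -[leRHS]mul1r ler_wpM2r ?invr_ge0 ?(ltW h0) //; case/andP: xs01.
by rewrite divr_gt0 //; lra.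
Qed.

Let c0_gt0 : 0 < c0.
Proof. by move: p2 pa a0 => *; rewrite mulr_gt0 ?subr_gt0 ?ltr_ln ?posrE //; lra. Qed.

Lemma occupation_dyadic j n :
  \sum_(m < n) tree_sum m (fun z => pi z * (2^-1 ^+ j.+1 < `|x z - xs|)%R%:R)
  <= j.+1%:R * (2 * ln 2 / c0).
Proof.
set h : R := 2^-1 ^+ j.+1.
have h0 : 0 < h by rewrite exprn_gt0 ?invr_gt0.
have h1 : h < 1 by rewrite exprn_ilt1 ?invr_ge0 ?invf_lt1 ?ltr1n.
have lnh : - ln h = j.+1%:R * ln 2.
  by rewrite /h exprVn lnV ?opprK ?posrE ?exprn_gt0 // lnXn // mulr_natl.
have R1 := occupation_right n h0 h1; have L1 := occupation_left n h0 h1.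
have E : \sum_(m < n) tree_sum m (fun z => pi z * (h < `|x z - xs|)%R%:R) <=
  \sum_(m < n) tree_sum m (fun z => pi z * (xs + h < x z)%R%:R) +
  \sum_(m < n) tree_sum m (fun z => pi z * (x z < xs - h)%R%:R).
  rewrite -big_split /=; apply: ler_sum => m _; rewrite -tree_sumD.
  apply: ler_tree_sum => z _; rewrite -mulrDr ler_wpM2l // -natrD ler_nat.
  case: ltP => //= hx; rewrite -addn1 ; case: ltP => //= hr; rewrite add0n lt0b.
  by move: hx; case: (lerP (x z) xs) => // *; lra.
rewrite mulrA ler_pdivlMr // mulrC.
have := ler_wpM2l (ltW c0_gt0) E; rewrite mulrDr; rewrite lnh in R1 L1; lra.
Qed.

(** Dyadic layers: with s = 2^(-del), D^del is at most the sum over j < J of s^j [D > 2^-(j+1)],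
    plus s^J. Occupation grows only linearly in j, and the sum of (j + 1) s^j is at most 1 / (1 -
    s)^2. *)
Lemma moment_sum_le (del : R) : 0 < del -> exists2 C : R, 0 <= C & forall n,
  \sum_(m < n) tree_sum m (fun z => pi z * `|x z - xs| `^ del) <= C.
Proof.
move=> del0; have [s sD] : exists s : R, s = 2^-1 `^ del by eexists.
have s0 : 0 < s by rewrite sD powR_gt0 ?invr_gt0.
have s1 : s < 1.
  rewrite sD; have := @gt0_ltr_powR R del del0 2^-1 1; rewrite powR1; apply;
    by rewrite ?inE ?nnegrE ?invr_ge0 ?invf_lt1 ?ltr1n.
pose K := 2 * ln 2 / c0.
have K0 : 0 <= K by rewrite divr_ge0 ?(ltW c0_gt0) // mulr_ge0 // ln_ge0 // ler1n.
exists (K / (1 - s) ^+ 2); first exact: (divr_ge0 K0 (sqr_ge0 _)).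
move=> n.
have level D J : 0 <= D <= 1 ->
    D `^ del <= \sum_(j < J) s ^+ j * (2^-1 ^+ j.+1 < D)%R%:R + s ^+ J.
  move=> /andP[D0 D1].
  have Dle j : D <= 2^-1 ^+ j -> D `^ del <= s ^+ j.
    move=> Dj; rewrite sD -powR_mulrn ?powR_ge0 // -powRrM mulrC powRrM powR_mulrn ?invr_ge0 //.
    by apply: ge0_ler_powR; rewrite ?nnegrE ?(ltW del0) ?exprn_ge0 ?invr_ge0.
  elim: J => [|J IH]; first by rewrite big_ord0 add0r Dle ?expr0.
  rewrite big_ord_recr /=; case: ltP => DJ.
    by rewrite mulr1; apply: le_trans IH _; rewrite lerDl exprn_ge0 ?(ltW s0).
  rewrite mulr0 addr0 (le_trans (Dle _ DJ)) // lerDr sumr_ge0 // => j _.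
  by rewrite mulr_ge0 ?ler0n ?exprn_ge0 // ltW.
have arith J : \sum_(j < J) s ^+ j * j.+1%:R <= ((1 - s) ^+ 2)^-1.
  suff : \sum_(j < J) s ^+ j * j.+1%:R * (1 - s) ^+ 2 <= 1.
    by rewrite -mulr_suml -ler_pdivlMr ?mul1r // exprn_gt0 // subr_gt0.
  have -> : \sum_(j < J) s ^+ j * j.+1%:R * (1 - s) ^+ 2
      = 1 - s ^+ J * (J%:R * (1 - s) + 1).
    elim: J => [|J IH]; first by rewrite big_ord0 expr0 mul0r add0r mulr1 subrr.
    by rewrite big_ord_recr /= IH (exprS s J) -natr1; ring.
  by rewrite gerBl mulr_ge0 ?exprn_ge0 ?addr_ge0 ?mulr_ge0 // ?ltW // subr_gt0.
have bound J : \sum_(m < n) tree_sum m (fun z => pi z * `|x z - xs| `^ del)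
    <= K / (1 - s) ^+ 2 + n%:R * s ^+ J.
  have D01 z : 0 <= `|x z - xs| <= 1.
    rewrite normr_ge0 ler_norml; move: (x01 z) xs01 => /andP[? ?] /andP[? ?].
    by apply/andP; split; lra.
  apply: (@le_trans _ _ (\sum_(j < J) s ^+ j * \sum_(m < n)
      tree_sum m (fun z => pi z * (2^-1 ^+ j.+1 < `|x z - xs|)%R%:R) + n%:R * s ^+ J)).
    under [X in _ <= X + _]eq_bigr do rewrite mulr_sumr.
    have -> : n%:R * s ^+ J = \sum_(m < n) s ^+ J.
      by rewrite sumr_const card_ord mulr_natl.
    rewrite exchange_big /= -big_split /=; apply: ler_sum => m _.
    have -> : \sum_(i < J) s ^+ i * tree_sum m (fun z => pi z * (2^-1 ^+ i.+1 < `|x z - xs|)%R%:R)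
      = tree_sum m (fun z => pi z * \sum_(i < J) s ^+ i * (2^-1 ^+ i.+1 < `|x z - xs|)%R%:R).
      elim: J => [|J IH].
        rewrite big_ord0; transitivity (tree_sum m (fun z => 0 * pi z)).
          by rewrite tree_sumZ mul0r.
        by apply: eq_tree_sum => z _; rewrite big_ord0 mulr0 mul0r.
      rewrite big_ord_recr /= IH -tree_sumZ -tree_sumD; apply: eq_tree_sum => z _.
      by rewrite big_ord_recr /= mulrDr; congr (_ + _); rewrite mulrCA.
    have -> : s ^+ J = tree_sum m (fun z => pi z * s ^+ J).
      transitivity (tree_sum m (fun z => s ^+ J * pi z)).
        by rewrite tree_sumZ tree_sum_harmonic // pi_nil mulr1.
      by apply: eq_tree_sum => z _; rewrite mulrC.
    rewrite -tree_sumD; apply: ler_tree_sum => z _.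
    by rewrite -mulrDr ler_wpM2l // level.
  rewrite lerD2r; apply: (@le_trans _ _ (\sum_(j < J) s ^+ j * j.+1%:R * K)).
    apply: ler_sum => j _; rewrite -mulrA ler_wpM2l ?exprn_ge0 ?(ltW s0) //.
    exact: occupation_dyadic.
  by rewrite -mulr_suml mulrC ler_wpM2l // arith.
(* For fixed n the remainder n s^J tends to 0 as J grows, which leaves a constant independent of
   n. *)
apply/ler_addgt0Pr => e e0.
have /cvgrPdist_lt/(_ _ e0)[J _ HJ] : n%:R * s ^+ J @[J --> \oo] --> (0 : R).
  rewrite -(mulr0 n%:R); apply: cvgMr; apply: cvg_expr.
  by rewrite ger0_norm // ltW.
apply: le_trans (bound J) _; rewrite lerD2l.
have := HJ J (leqnn J); rewrite /= sub0r normrN => /ltW; apply: le_trans; exact: ler_norm.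
Qed.

End MomentSum.

(** * Posterior densities and their medians *)

Section PosteriorDensity.
Context {R : realType}.
Implicit Types (p x y : R) (f F : R -> R) (z : seq bool) (b : bool).

Local Notation mu := (@lebesgue_measure R).

Lemma bisect_surj p b (t : R) : 0 < p < 1 -> 0 <= t <= 1 ->
  exists2 u, 0 <= u <= 1 & bisect p b u = t.
Proof.
move=> /andP[p0 p1] /andP[t0 t1]; rewrite /bisect; set a := if b then p else 1 - p.
have [a0 a1] : 0 < a /\ 0 < 1 - a by rewrite /a; case: b {a}; split; lra.
clearbody a; have [ta|ta] := lerP t (1 - a).
  exists (t / (2 * (1 - a))).
    by rewrite divr_ge0 ?mulr_ge0 ?(ltW a1) //= ler_pdivrMr ?mulr_gt0 //; lra.
  rewrite ifT; first by field; apply: lt0r_neq0.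
  by rewrite ler_pdivrMr ?mulr_gt0 //; lra.
have d0 : 0 <= (1 - t) / (2 * a) by rewrite divr_ge0 ?mulr_ge0 ?(ltW a0) //; lra.
have d1 : (1 - t) / (2 * a) < 2^-1 by rewrite ltr_pdivrMr ?mulr_gt0 //; lra.
exists (1 - (1 - t) / (2 * a)); first by apply/andP; split; lra.
rewrite ifF; first by field; apply: lt0r_neq0.
by apply/negbTE; rewrite -ltNge; lra.
Qed.

(** Provides the existence of medians by inverting the updates one at a time, with no appeal to
    continuity. *)
Lemma posterior_cdf_surj p z (t : R) : 0 < p < 1 -> 0 <= t <= 1 ->
  exists2 x, 0 <= x <= 1 & posterior_cdf p z x = t.
Proof.
move=> p01; elim: z t => [|b z IH] t t01; first by exists t.
have [u u01 <-] := bisect_surj b p01 t01.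
by have [x x01 xu] := IH _ u01; exists x => //=; rewrite -/(posterior_cdf p z x) xu.
Qed.

(** Half-open intervals fit [update], which counts the median itself on the right. *)
Definition has_cdf f F : Prop :=
  [/\ measurable_fun setT f, forall x, 0 <= f x &
      forall x y, 0 <= x -> x <= y -> y <= 1 ->
        (\int[mu]_(t in `[x, y[) (f t)%:E)%E = (F y - F x)%:E].

Lemma integral_itv_split f x m y : measurable_fun setT f -> (forall t, 0 <= f t) ->
  x <= m -> m <= y ->
  (\int[mu]_(t in `[x, y[) (f t)%:E)%E =
  (\int[mu]_(t in `[x, m[) (f t)%:E + \int[mu]_(t in `[m, y[) (f t)%:E)%E.
Proof.
move=> mf f0 xm my; rewrite (@itv_bndbnd_setU _ _ _ (BLeft m)) ?bnd_simp //.
rewrite ge0_integral_setU //.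
- by apply/measurable_EFinP; apply: measurable_funS mf.
- by move=> t _; rewrite lee_fin.
- apply/disj_setPS => t [] /=; rewrite !in_itv /= => /andP[_ tm] /andP[mt _].
  by move: tm; rewrite ltNge mt.
Qed.

Lemma has_cdf_scale f F (k x y : R) g : has_cdf f F -> 0 <= k ->
  0 <= x -> x <= y -> y <= 1 -> (forall t, x <= t < y -> g t = k * f t) ->
  (\int[mu]_(t in `[x, y[) (g t)%:E)%E = (k * (F y - F x))%:E.
Proof.
move=> [mf f0 If] k0 x0 xy y1 gk.
rewrite EFinM -If // -ge0_integralZl_EFin //.
- by apply: eq_integral => t; rewrite inE /= in_itv /= => /gk ->; rewrite EFinM.
- by move=> t _; rewrite lee_fin.
- by apply/measurable_EFinP; apply: measurable_funS mf.
Qed.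

(** The two branches of [bisect] agree at the median because the cdf is 1/2 there, so an interval
    containing m can be split at m. *)
Lemma update_cdf p b z f m : 0 < p < 1 -> has_cdf f (posterior_cdf p z) ->
  0 <= m <= 1 -> posterior_cdf p z m = 2^-1 ->
  has_cdf (update p f m b) (posterior_cdf p (b :: z)).
Proof.
move=> p01 cf /andP[m0 m1] Fm; have [mf f0 If] := cf.
have /andP[p0 p1] := p01.
pose a := if b then p else 1 - p.
have [a0 a1] : 0 <= a /\ 0 <= 1 - a by rewrite /a; case: (b); split; lra.
have updE t : update p f m b t = if m <= t then 2 * a * f t else 2 * (1 - a) * f t.
  by rewrite /update /a; case: (b); case: ifP; rewrite ?subKr.
have mono x y : x <= y -> posterior_cdf p z x <= posterior_cdf p z y.
  by rewrite le_eqVlt => /orP[/eqP ->//|/(posterior_cdf_mono z p01)/ltW].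
have lowE x : x <= m -> posterior_cdf p (b :: z) x = 2 * (1 - a) * posterior_cdf p z x.
  by move=> /mono; rewrite Fm /= /bisect -/(posterior_cdf p z x) => ->.
have highE x : m <= x -> posterior_cdf p (b :: z) x = 1 - 2 * a * (1 - posterior_cdf p z x).
  move=> /mono; rewrite Fm /= /bisect -/(posterior_cdf p z x) -/a => Fx.
  case: lerP => // Fx'; have -> : posterior_cdf p z x = 2^-1 by lra.
  by field.
have upd0 t : 0 <= update p f m b t by rewrite updE; case: ifP; rewrite !mulr_ge0.
have mupd : measurable_fun setT (update p f m b).
  have -> : update p f m b = fun t => if m <= t then 2 * a * f t else 2 * (1 - a) * f t.
    exact/funext.
  apply: measurable_fun_ifT; first exact: measurable_fun_ler.
    exact: measurable_funM.
  exact: measurable_funM.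
have low x y : 0 <= x -> x <= y -> y <= m ->
    (\int[mu]_(t in `[x, y[) (update p f m b t)%:E)%E =
    (posterior_cdf p (b :: z) y - posterior_cdf p (b :: z) x)%:E.
  move=> x0 xy ym; rewrite (has_cdf_scale (k := 2 * (1 - a)) cf) ?mulr_ge0 //.
  - by rewrite !lowE ?(le_trans xy) // mulrBr.
  - exact: le_trans ym m1.
  - by move=> t /andP[_ ty]; rewrite updE leNgt (lt_le_trans ty ym).
have high x y : m <= x -> x <= y -> y <= 1 ->
    (\int[mu]_(t in `[x, y[) (update p f m b t)%:E)%E =
    (posterior_cdf p (b :: z) y - posterior_cdf p (b :: z) x)%:E.
  move=> mx xy y1; rewrite (has_cdf_scale (k := 2 * a) cf) ?mulr_ge0 //.
  - by rewrite !highE ?(le_trans mx) //; congr EFin; ring.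
  - exact: le_trans m0 mx.
  - by move=> t /andP[xt _]; rewrite updE (le_trans mx xt).
split=> // x y x0 xy y1.
have [ym|my] := lerP y m; first exact: low.
have [xm|mx] := lerP m x; first exact: high.
rewrite (@integral_itv_split _ x m y) ?(ltW mx) ?(ltW my) // low ?high ?(ltW mx) ?(ltW my) //.
by rewrite -EFinD; congr EFin; ring.
Qed.

Lemma median_unique p z f m : 0 < p < 1 -> has_cdf f (posterior_cdf p z) ->
  is_median f m <-> 0 <= m <= 1 /\ posterior_cdf p z m = 2^-1.
Proof.
move=> p01 [mf f0 If].
have mfS A : measurable A -> measurable_fun A (EFin \o f).
  by move=> mA; apply/measurable_EFinP; apply: measurable_funS mf.
have lowE x : 0 <= x <= 1 ->
    (\int[mu]_(t in `[0%R, x]) (f t)%:E)%E = (posterior_cdf p z x)%:E.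
  move=> /andP[x0 x1]; rewrite -integral_itv_bndo_bndc; last exact: mfS.
  by rewrite If // posterior_cdf0 subr0.
have highE x : 0 <= x <= 1 ->
    (\int[mu]_(t in `[x, 1%R]) (f t)%:E)%E = (1 - posterior_cdf p z x)%:E.
  move=> /andP[x0 x1]; rewrite -integral_itv_bndo_bndc; last exact: mfS.
  by rewrite If // posterior_cdf1.
split=> [[m01]|[m01 Fm]]; first by rewrite lowE // => -[->].
by split=> //; rewrite ?lowE ?highE // Fm; congr EFin; field.
Qed.

Lemma medianP p z f : 0 < p < 1 -> has_cdf f (posterior_cdf p z) ->
  0 <= median f <= 1 /\ posterior_cdf p z (median f) = 2^-1.
Proof.
move=> p01 cf; rewrite -(median_unique _ p01 cf).
have [|x x01 Fx] := @posterior_cdf_surj p z 2^-1 p01.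
  by apply/andP; split; lra.
rewrite /median; apply: (@xgetPex _ 0 [set x | is_median f x]).
by exists x; apply/(median_unique _ p01 cf).
Qed.

(** Noise enters the density only through the test results, so bit strings index all states of the
    algorithm and the query point is a deterministic function of the string. *)
Fixpoint posterior_density p z : R -> R :=
  if z is b :: z' then
    update p (posterior_density p z') (median (posterior_density p z')) b
  else uniform_density.

Lemma posterior_densityP p z : 0 < p < 1 ->
  has_cdf (posterior_density p z) (posterior_cdf p z).
Proof.
move=> p01; elim: z => [|b z IH]; last first.
  by have [m01 Fm] := medianP p01 IH; apply: update_cdf.
split=> [|x|x y x0 xy y1].
- exact: measurable_indic.
- by rewrite /= /uniform_density indicE.
transitivity (\int[mu]_(t in `[x, y[) (cst 1%E) t)%E.
  apply: eq_integral => t; rewrite inE /= in_itv /= => /andP[xt ty].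
  by rewrite /uniform_density indicE mem_set //= in_itv /= (le_trans x0 xt) ltW // (lt_le_trans ty).
rewrite integral_cst //= mul1e lebesgue_measure_itv /= lte_fin.
by move: xy; rewrite le_eqVlt => /orP[/eqP ->|->]; rewrite ?ltxx ?subrr.
Qed.

Definition query_point p z : R := median (posterior_density p z).

Lemma query_pointP p z : 0 < p < 1 ->
  0 <= query_point p z <= 1 /\ posterior_cdf p z (query_point p z) = 2^-1.
Proof. by move=> p01; apply: medianP p01 (posterior_densityP _ p01). Qed.

End PosteriorDensity.

(** * Test lengths *)

Section TailBound.
Context {R : realType}.
Implicit Types (gamma th c D del : R) (M : nat).

Lemma walk_small_le1 th gamma M : 0 <= th <= 1 ->
  tree_sum M (fun s => (`|tally_diff s : R| < boundary gamma M)%R%:R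
    * bernoulli_weight th s) <= 1.
Proof.
move=> th01; rewrite -[leRHS](tree_sum_bernoulli_weight th M).
apply: ler_tree_sum => s _.
have le1 (b : bool) : b%:R <= 1 :> R by case: b; rewrite ?lexx ?ler01.
by rewrite ler_piMl ?bernoulli_weight_ge0.
Qed.

Lemma ln_le_powR (t b : R) : 0 < t -> 0 < b -> ln t <= t `^ b / b.
Proof.
move=> t0 b0; rewrite ler_pdivlMr // mulrC -ln_powR.
have tb : 0 < t `^ b by rewrite powR_gt0.
have := @le_ln1Dx R (t `^ b - 1); rewrite subrKC => H.
by apply: le_trans (H _) _; [rewrite ltrBrDl subrr|rewrite gerBl].
Qed.

(* Chebyshev's inequality applies once M D^2 exceeds a multiple of
   ln (M + 1) - ln gamma; before that the bound K >= (M + 1) D^(2 + del) is the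
   reason for the loss of del in the exponent. *)
Lemma walk_small_tail gamma c del : 0 < gamma < 1 -> 0 < c -> 0 < del ->
  exists2 K : R, 1 <= K & forall th D M, 0 <= th <= 1 -> 0 < D <= 1 ->
    c * D <= `|th - 2^-1| ->
    tree_sum M (fun s => (`|tally_diff s : R| < boundary gamma M)%R%:R
      * bernoulli_weight th s) <= K / (M.+1%:R * D `^ (2 + del)).
Proof.
have one (x : R) : 1 `^ x = 1 by rewrite powR1.
(* Chosen so that b (1 + del / 2) = del / 2: raising t D^2 <= C t^b to the power 1 + del / 2 leaves
   t D^(2 + del) <= C^(1 + del / 2). *)
move=> /andP[g0 g1] c0 del0; pose b := del / (2 + del).
have b0 : 0 < b by rewrite divr_gt0 // addr_gt0.
have lng : ln gamma < 0 by rewrite -ln1 ltr_ln ?posrE.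
have c2 : 0 < c ^+ 2 by rewrite exprn_gt0.
(* The logarithmic threshold is bounded through ln t <= t^b / b; the final 1 pays for M + 1 in place
   of M. *)
pose C := 2 / c ^+ 2 * (b^-1 - ln gamma) + 1.
have C1 : 1 <= C.
  by rewrite lerDr mulr_ge0 // ?divr_ge0 ?(ltW c2) // subr_ge0 (le_trans (ltW lng)) // invr_ge0 ltW.
exists (C `^ (1 + del / 2) + 2 / c ^+ 2).
  rewrite -[leLHS]addr0 lerD ?divr_ge0 ?(ltW c2) //.
  by rewrite -[leLHS](one (1 + del / 2)) ge0_ler_powR ?nnegrE //; lra.
move=> th D M th01 /andP[D0 D1] cD.
pose t : R := M.+1%:R; have t1 : 1 <= t by rewrite ler1n.
have t0 : 0 < t by lra.
have DD : 0 < D `^ (2 + del) by rewrite powR_gt0.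
have Dle : D `^ (2 + del) <= D ^+ 2.
  rewrite -powR_mulrn ?(ltW D0) // powRD ?(gt_eqF D0) ?implybT //.
  by rewrite ler_piMr ?powR_ge0 // -[leRHS](one del) ge0_ler_powR ?nnegrE ?(ltW D0) ?(ltW del0).
have bE : boundary gamma M = Num.sqrt (2 * M%:R * (ln t - ln gamma)) by [].
have lt0 : 0 <= ln t by apply: ln_ge0.
rewrite ler_pdivlMr ?mulr_gt0 // -/t.
have [small|large] := ltrP (M%:R * c ^+ 2 * D ^+ 2) (2 * (ln t - ln gamma)).
  apply: (@le_trans _ _ (t * D `^ (2 + del))).
    by rewrite ler_piMl ?walk_small_le1 // mulr_ge0 ?ltW.
  rewrite ler_wpDr ?divr_ge0 ?(ltW c2) //.
  have tD : t * D ^+ 2 <= C * t `^ b.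
    have tb1 : 1 <= t `^ b.
      by rewrite -[leLHS](one b) ge0_ler_powR ?nnegrE ?(ltW b0) ?(ltW t0).
    have h1 : t * D ^+ 2 <= M%:R * D ^+ 2 + 1.
      by rewrite /t -natr1 mulrDl mul1r lerD2l expr_le1 // ltW.
    have h2 : M%:R * D ^+ 2 <= 2 / c ^+ 2 * (ln t - ln gamma).
      have -> : 2 / c ^+ 2 * (ln t - ln gamma) = 2 * (ln t - ln gamma) / c ^+ 2 by rewrite mulrAC.
      by rewrite ler_pdivlMr // mulrAC ltW.
    have h3 := ln_le_powR t0 b0.
    have h4 : ln t - ln gamma <= (b^-1 - ln gamma) * t `^ b by nra.
    have h5 : 2 / c ^+ 2 * (ln t - ln gamma) <= 2 / c ^+ 2 * ((b^-1 - ln gamma) * t `^ b).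
      by rewrite ler_wpM2l // divr_ge0 ?(ltW c2).
    rewrite /C; lra.
  have e0 : 0 < 1 + del / 2 by lra.
  have : (t * D ^+ 2) `^ (1 + del / 2) <= (C * t `^ b) `^ (1 + del / 2).
    by rewrite ge0_ler_powR ?nnegrE ?mulr_ge0 ?powR_ge0 ?sqr_ge0 ?(ltW e0) ?(ltW t0) //; lra.
  rewrite -[D ^+ 2]powR_mulrn ?(ltW D0) // powRM ?powR_ge0 ?(ltW t0) //.
  rewrite [(C * _) `^ _]powRM ?powR_ge0 ?(le_trans _ C1) // -!powRrM.
  have -> : 2%:R * (1 + del / 2) = 2 + del by field.
  have -> : b * (1 + del / 2) = del / 2.
    by rewrite /b; field; apply: lt0r_neq0; lra.
  rewrite [t `^ (1 + _)]powRD ?(gt_eqF t0) ?implybT // powRr1 ?(ltW t0) //.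
  have T0 : 0 < t `^ (del / 2) by rewrite powR_gt0.
  by rewrite mulrAC [leRHS]mulrC (mulrC _ (t `^ _)) ler_pM2l.
have M0 : (0 < M)%N.
  rewrite lt0n; apply/eqP => M0; move: large; rewrite M0 !mul0r; apply/negP.
  by rewrite -ltNge; lra.
have MR : 0 < M%:R :> R by rewrite ltr0n.
pose k := boundary gamma M.
(* The boundary is at most half of 2 M c D, a lower bound for the modulus of the walk's mean, so
   Chebyshev's inequality has a gap of at least M c D. *)
have kle : k <= M%:R * (c * D).
  rewrite /k bE -[leRHS]ger0_norm -?sqrtr_sqr ?mulr_ge0 ?(ltW c0) ?(ltW D0) //.
  apply: ler_wsqrtr.
  have -> : (M%:R * (c * D)) ^+ 2 = M%:R * (M%:R * c ^+ 2 * D ^+ 2) by ring.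
  have -> : 2 * M%:R * (ln t - ln gamma) = M%:R * (2 * (ln t - ln gamma)) by ring.
  by rewrite ler_wpM2l.
have mu : 2 * (c * D) <= `|2 * th - 1|.
  have -> : 2 * th - 1 = 2 * (th - 2^-1) by field.
  by rewrite normrM ger0_norm // ler_wpM2l.
have cD0 : 0 < c * D by rewrite mulr_gt0.
have kmu : M%:R * (c * D) <= M%:R * `|2 * th - 1| - k by nra.
have := @tree_sum_walk_small R th M k th01 _.
set S := tree_sum _ _ => H.
have S0 : 0 <= S.
  by apply: tree_sum_ge0 => s _; rewrite mulr_ge0 ?bernoulli_weight_ge0.
have {}H : (M%:R * (c * D)) ^+ 2 * S <= M%:R.
  apply: (le_trans _ (H _)); last by nra.
  rewrite ler_wpM2r //; apply: lerXn2r; rewrite ?nnegrE ?mulr_ge0 ?(ltW c0) ?(ltW D0) //.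
  by apply: le_trans kmu; rewrite mulr_ge0 // ltW.
have SM : S * (M%:R * D ^+ 2) <= 1 / c ^+ 2.
  rewrite ler_pdivlMr // -(ler_pM2l MR) mulr1; apply: (le_trans _ H).
  by rewrite le_eqVlt; apply/orP; left; apply/eqP; ring.
apply: (@le_trans _ _ (2 / c ^+ 2)); last by rewrite lerDr powR_ge0.
apply: (@le_trans _ _ (S * (2 * M%:R * D ^+ 2))).
  rewrite ler_wpM2l // ler_pM ?(ltW t0) ?(ltW DD) //.
  have : 1 <= M%:R :> R by rewrite ler1n.
  by rewrite /t -natr1; lra.
by move: SM; lra.
Qed.

End TailBound.

(** * Error of the weighted mean *)

Section WeightedMean.
Context {R : realType}.

(** For q in [0, 1] and a <= 1, q <= q^a; apply this to the shares x / (x + y) and y / (x + y),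
    which add up to 1. *)
Lemma powR_subadditive (a x y : R) : 0 < a <= 1 -> 0 <= x -> 0 <= y ->
  (x + y) `^ a <= x `^ a + y `^ a.
Proof.
move=> /andP[a0 a1] x0 y0; have [s0|s0] := ltrP 0 (x + y); last first.
  have -> : x + y = 0 by lra.
  by rewrite powR0 ?gt_eqF // addr_ge0 ?powR_ge0.
have part t : 0 <= t -> t <= x + y -> (x + y) `^ a * (t / (x + y)) <= t `^ a.
  move=> t0 ts; have [->|tn] := eqVneq t 0; first by rewrite mul0r mulr0 powR_ge0.
  have tp : 0 < t by rewrite lt_neqAle eq_sym tn.
  have q0 : 0 < t / (x + y) by rewrite divr_gt0.
  have q1 : t / (x + y) <= 1 by rewrite ler_pdivrMr ?mul1r.
  rewrite -[t in leRHS](divfK (lt0r_neq0 s0)) mulrC powRM ?(ltW q0) ?(ltW s0) //.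
  rewrite ler_wpM2r ?powR_ge0 // -[leLHS]powRr1 ?(ltW q0) // ger_powR ?q0 //.
have := part x x0; have := part y y0; rewrite lerDl lerDr x0 y0 => /(_ isT) hy /(_ isT) hx.
have -> : (x + y) `^ a = (x + y) `^ a * (x / (x + y)) + (x + y) `^ a * (y / (x + y)).
  by rewrite -mulrDr -mulrDl divff ?mulr1 ?lt0r_neq0.
exact: lerD.
Qed.

Lemma weighted_mean_dist (I : Type) (r : seq I) (N : I -> nat) (x : I -> R) (xs a : R) :
  0 < a <= 1 ->
  `|(\sum_(i <- r) (N i)%:R `^ a * x i) / (\sum_(i <- r) (N i)%:R `^ a) - xs|
    * (\sum_(i <- r) N i)%:R `^ a
  <= \sum_(i <- r) (N i)%:R `^ a * `|x i - xs|.
Proof.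
move=> a01; have a0 : 0 < a by case/andP: a01.
set A := \sum_(i <- r) (N i)%:R `^ a.
have A0 : 0 <= A by apply: sumr_ge0 => i _; exact: powR_ge0.
have TA : (\sum_(i <- r) N i)%:R `^ a <= A.
  rewrite /A; elim: r {A A0} => [|i r IH]; first by rewrite !big_nil powR0 ?gt_eqF.
  rewrite !big_cons natrD (le_trans (powR_subadditive a01 _ _)) //.
  by rewrite lerD2l.
have V0 : 0 <= \sum_(i <- r) (N i)%:R `^ a * `|x i - xs|.
  by apply: sumr_ge0 => i _; rewrite mulr_ge0 ?powR_ge0.
(* If all lengths are 0, the quotient is the default value 0, but the power of the total length
   vanishes as well. *)
have [Az|An] := eqVneq A 0.
  have -> : (\sum_(i <- r) N i)%:R `^ a = 0.
    by apply/eqP; rewrite eq_le powR_ge0 andbT -Az.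
  by rewrite mulr0.
have Ap : 0 < A by rewrite lt_neqAle eq_sym An.
have -> : (\sum_(i <- r) (N i)%:R `^ a * x i) / A - xs
    = (\sum_(i <- r) (N i)%:R `^ a * (x i - xs)) / A.
  under [in RHS]eq_bigr do rewrite mulrBr.
  by rewrite sumrB -mulr_suml -/A mulrBl mulrAC divff // mul1r.
rewrite normrM normfV (ger0_norm A0).
apply: (@le_trans _ _ (`|\sum_(i <- r) (N i)%:R `^ a * (x i - xs)| / A * A)).
  by rewrite ler_wpM2l // mulr_ge0 ?invr_ge0.
rewrite divfK //; apply: le_trans (ler_norm_sum _ _ _) _.
by apply: ler_sum => i _; rewrite normrM (ger0_norm (powR_ge0 _ _)).
Qed.

End WeightedMean.

(** * Measurability and probability trees *)

Section Measurability.
Context {d : measure_display} {T : measurableType d} {R : realType}.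

Lemma measurable_countable_preimage (K : countType) (phi : T -> K) (Q : set K) :
  (forall k, measurable [set w | phi w = k]) -> measurable [set w | Q (phi w)].
Proof.
move=> mphi.
have -> : [set w | Q (phi w)] =
    \bigcup_k ([set w | phi w = k] `&` [set w | Q k]).
  apply/seteqP; split => [w Qw|w [k _ [/= <-]//]].
  by exists (phi w).
apply: countable_bigcupT_measurable => [|k]; first exact: countableP.
apply: measurableI => //; case: (pselect (Q k)) => Qk.
  by rewrite (_ : [set _ | _] = setT) //; apply/seteqP; split.
by rewrite (_ : [set _ | _] = set0) //; apply/seteqP; split.
Qed.

Lemma measurable_fun_countable (K : countType) (phi : T -> K) (h : K -> R) :
  (forall k, measurable [set w | phi w = k]) ->
  measurable_fun setT (fun w => h (phi w)).
Proof.
move=> mphi _ B mB; rewrite setTI.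
exact: (@measurable_countable_preimage _ phi [set k | B (h k)]).
Qed.

Implicit Types (gamma : R) (y : nat -> T -> R).

Lemma measurable_sign_string y n s :
  (forall i c, measurable [set w | (0 <= y i w) = c]) ->
  measurable [set w | sign_string n (y^~ w) = s].
Proof.
move=> my; elim: n s => [|n IH] [|b s] /=.
- by rewrite (_ : [set _ | _] = setT) //; apply/seteqP; split.
- by rewrite (_ : [set _ | _] = set0) //; apply/seteqP; split.
- by rewrite (_ : [set _ | _] = set0) //; apply/seteqP; split.
- rewrite (_ : [set _ | _] = [set w | (0 <= y n w) = b]
    `&` [set w | sign_string n (y^~ w) = s]); first exact: measurableI.
  by apply/seteqP; split => w /= [-> ->].
Qed.

Lemma exits_stop_time gamma (v : nat -> R) n : exits gamma v n ->
  (stop_time gamma v <= n)%N.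
Proof.
move=> ex; rewrite /stop_time; case: pselect => [h|[]]; last by exists n.
by case: ex_minnP => m _ mmin; exact: mmin.
Qed.

Lemma stop_timeP gamma (v : nat -> R) n : (0 < n)%N ->
  stop_time gamma v = n <-> exits gamma v n /\ forall m, (m < n)%N -> ~~ exits gamma v m.
Proof.
rewrite /stop_time => n0; case: pselect => [h|nh]; last first.
  by split=> [E|[ex _]]; [move: n0; rewrite -E|case: nh; exists n].
case: ex_minnP => m exm mmin; split => [<-|[exn noex]].
  by split=> // k km; apply/negP => /mmin; rewrite leqNgt km.
apply/eqP; rewrite eqn_leq mmin //= leqNgt; apply/negP => /noex.
by rewrite exm.
Qed.

Lemma noexit_of_stop_time gamma (v : nat -> R) n m : (n <= m)%N ->
  (m < stop_time gamma v)%N -> ~~ exits gamma v n.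
Proof.
by move=> nm ms; apply/negP => /exits_stop_time; rewrite leqNgt (leq_ltn_trans nm ms).
Qed.

Lemma measurable_stop_time gamma y k :
  (forall i c, measurable [set w | (0 <= y i w) = c]) ->
  measurable [set w | stop_time gamma (y^~ w) = k].
Proof.
move=> my; have ms n s := @measurable_sign_string y n s my.
have pos n : measurable [set w | stop_time gamma (y^~ w) = n.+1].
  rewrite (_ : [set _ | _] = [set w | [set s | exits_string gamma s
      /\ verdict gamma (behead s) = None] (sign_string n.+1 (y^~ w))]).
    exact: measurable_countable_preimage.
  apply/seteqP; split=> w /=; rewrite (stop_timeP _ _ (ltn0Sn n)).
    move=> [ex noex]; rewrite exitsE in ex; split=> //.
    by apply/verdict_sign_string_None => m mn; apply: noex; rewrite ltnS.
  move=> [ex /verdict_sign_string_None noex]; rewrite exitsE; split=> //.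
case: k => [|k //].
rewrite (_ : [set _ | _] = ~` \bigcup_n [set w | stop_time gamma (y^~ w) = n.+1]).
  by apply/measurableC/bigcupT_measurable.
apply/seteqP; split=> w /=; first by move=> E [n _ /=]; rewrite E.
by move=> H; case E: (stop_time _ _) => [//|n]; case: H; exists n.
Qed.

(** Only signs actually observed are assumed measurable, so that the lemma applies to the
    sigma-algebra of the past. A string whose tail carries no verdict is tested by observed signs
    alone, and the result is true iff one of countably many such strings occurs with verdict
    true. *)
Lemma measurable_test_sign gamma y b : 0 < gamma < 1 ->
  (forall i c, measurable [set w | observed gamma (y^~ w) i /\ (0 <= y i w) = c]) ->
  measurable [set w | test_sign gamma (y^~ w) = b].
Proof.
move=> g01 my; pose E s := [set w | sign_string (size s) (y^~ w) = s].
have mE s : verdict gamma (behead s) = None -> measurable (E s).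
  elim: s => [|c s IH] /= vs.
    by rewrite (_ : E _ = setT) //; apply/seteqP; split.
  have {}IH : measurable (E s).
    apply: IH; case: s vs => //= c' s; by case: (verdict gamma s).
  rewrite (_ : E _ = E s `&`
    [set w | observed gamma (y^~ w) (size s) /\ (0 <= y (size s) w) = c]).
    exact: measurableI.
  apply/seteqP; split=> w /=; rewrite /E /=.
    move=> [<- sE]; do 2!split => //; apply/verdict_sign_string_None.
    by rewrite sE.
  by move=> [-> [_ ->]].
pose A s := E s `&`
  [set w | verdict gamma s = Some true /\ verdict gamma (behead s) = None].
have mtrue : measurable [set w | test_sign gamma (y^~ w) = true].
  rewrite (_ : [set _ | _] = \bigcup_s A s).
    apply: countable_bigcupT_measurable => [|s]; first exact: countableP.
    have [[vs bs]|nA] :=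
      pselect (verdict gamma s = Some true /\ verdict gamma (behead s) = None).
      rewrite (_ : A s = E s); first exact: mE.
      by apply/seteqP; split=> w; [case|move=> Ew; split].
    by rewrite (_ : A s = set0) //; apply/seteqP; split=> w // -[_ /= ?]; exfalso; exact: nA.
  apply/seteqP; split=> w /=.
    rewrite /test_sign; case st: (stop_time gamma (y^~ w)) => [|n].
      by rewrite /walk big_ord0 ltxx.
    have [ex noex] := (stop_timeP gamma (y^~ w) (ltn0Sn n)).1 st.
    move=> pos; exists (sign_string n.+1 (y^~ w)) => //; split.
      by rewrite /E /= size_sign_string.
    split; first by rewrite (verdict_sign_string_stop noex ex) pos.
    by apply/verdict_sign_string_None => m mn; apply: noex.
  move=> [s _ [Es [vs _]]]; apply: (verdict_test_sign (n := size s) g01).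
  by rewrite Es.
(* The complement includes the tests that never stop: their dummy length 0 gives a zero walk, hence
   the value false. *)
case: b => //; rewrite (_ : [set _ | _] = ~` [set w | test_sign gamma (y^~ w) = true]).
  exact: measurableC.
by apply/seteqP; split=> w /=; case: test_sign.
Qed.

End Measurability.

(** * Binary processes: probabilities as sums over strings *)

Section BinaryProcess.
Context {d : measure_display} {T : measurableType d} {R : realType}.
Variable P : probability T R.

Definition prob (A : set T) : R := fine (P A).

Lemma prob_fin A : measurable A -> P A = (prob A)%:E.
Proof. by move=> mA; rewrite fineK // fin_num_measure. Qed.

Lemma prob_ge0 A : 0 <= prob A.
Proof. exact: fine_ge0. Qed.

Lemma le_prob A B : measurable A -> measurable B -> A `<=` B -> prob A <= prob B.
Proof.
by move=> mA mB AB; rewrite -lee_fin -!prob_fin //; apply: le_measure; rewrite ?inE.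
Qed.

Lemma probU A B : measurable A -> measurable B -> A `&` B = set0 ->
  prob (A `|` B) = prob A + prob B.
Proof.
move=> mA mB AB; apply: EFin_inj; rewrite -prob_fin; last exact: measurableU.
by rewrite EFinD -!prob_fin //; exact: measureU.
Qed.

Lemma probU_le A B : measurable A -> measurable B ->
  prob (A `|` B) <= prob A + prob B.
Proof.
move=> mA mB; rewrite -lee_fin EFinD -!prob_fin //; last exact: measurableU.
exact: measureU2.
Qed.

Lemma prob0 : prob set0 = 0.
Proof. by rewrite /prob measure0. Qed.

Lemma probT : prob setT = 1.
Proof. by rewrite /prob probability_setT. Qed.

Variables (bit : nat -> T -> bool) (sigma : nat -> T -> seq bool).
Hypothesis sigma0 : forall w, sigma 0 w = [::].
Hypothesis sigmaS : forall n w, sigma n.+1 w = bit n w :: sigma n w.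
Hypothesis msigma : forall n s, measurable [set w | sigma n w = s].

Definition cylinder s := [set w | sigma (size s) w = s].

Lemma measurable_cylinder s : measurable (cylinder s).
Proof. exact: msigma. Qed.

Lemma prob_cylinder_split A s : measurable A ->
  prob (A `&` cylinder (true :: s)) + prob (A `&` cylinder (false :: s))
  = prob (A `&` cylinder s).
Proof.
move=> mA; have mAc t : measurable (A `&` cylinder t).
  exact: measurableI mA (measurable_cylinder t).
rewrite -probU //.
  congr prob; rewrite -setIUr; congr (_ `&` _); apply/seteqP; split=> w /=.
    by rewrite /cylinder /= !sigmaS => -[[_ ->]|[_ ->]].
  by rewrite /cylinder /= !sigmaS => ->; case: (bit _ _); [left|right].
apply/seteqP; split=> w //= [[_]]; rewrite /cylinder /= sigmaS => -[-> _] [_ +].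
by case.
Qed.

Lemma tree_sum_prob A n : measurable A ->
  tree_sum n (fun s => prob (A `&` cylinder s)) = prob A.
Proof.
move=> mA; rewrite tree_sum_harmonic => [|s]; last exact: prob_cylinder_split.
rewrite (_ : A `&` cylinder [::] = A) //; apply/seteqP; split=> w; first by case.
by move=> Aw; split=> //; rewrite /cylinder /= sigma0.
Qed.

(** Serves two processes: the signs within one test, and the test results of successive stages. *)
Lemma prob_event_tree_sum A n (Q : pred (seq bool)) : measurable A ->
  prob (A `&` [set w | Q (sigma n w)]) =
  tree_sum n (fun s => (Q s)%:R * prob (A `&` cylinder s)).
Proof.
move=> mA; have mQ : measurable [set w | Q (sigma n w)].
  exact: (@measurable_countable_preimage _ _ _ (sigma n) [set s | Q s]).
rewrite -(tree_sum_prob n); last exact: measurableI.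
apply: eq_tree_sum => s sn; case Qs: (Q s).
  rewrite mul1r; congr prob; apply/seteqP; split=> w /=; rewrite /cylinder /= sn.
    by move=> [[? _] ?].
  by move=> [? E]; rewrite E Qs.
rewrite mul0r -prob0; congr prob; apply/seteqP; split=> w //=; rewrite /cylinder /= sn.
by move=> [[_ +] E]; rewrite E Qs.
Qed.

End BinaryProcess.

(** * The algorithm as a binary process *)

Section Algorithm.
Context {R : realType} {d : measure_display} {T : measurableType d}.
Variables (P : probability T R) (g : R -> R).
Variables (nu : R -> probability (measurableTypeR R) R) (gamma p : R).
Variable e : nat -> nat -> {mfun T >-> measurableTypeR R}.
Hypothesis gamma01 : 0 < gamma < 1.

Fixpoint sign_history n w : seq bool :=
  if n is n'.+1 then
    test_sign gamma (evaluations g (query_point p (sign_history n' w))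
      (fun i => e n' i w)) :: sign_history n' w
  else [::].

Lemma size_sign_history n w : size (sign_history n w) = n.
Proof. by elim: n => //= n ->. Qed.

Lemma pba_densityE n w :
  pba_density g gamma p uniform_density (fun j i => e j i w) n
  = posterior_density p (sign_history n w).
Proof. by elim: n => [//|n IH] /=; rewrite IH. Qed.

Lemma pba_XE n w :
  pba_X g gamma p uniform_density (fun j i => e j i w) n
  = query_point p (sign_history n w).
Proof. by rewrite /pba_X pba_densityE. Qed.

(* Evaluation number i + 1 of the test that follows the test results z. *)
Definition evaluation z i (w : T) : R := g (query_point p z) + e (size z) i w.

Lemma pba_YE n w :
  pba_Y g gamma p uniform_density (fun j i => e j i w) n
  = (evaluation (sign_history n w))^~ w.
Proof.
rewrite /pba_Y pba_XE; apply/funext => i.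
by rewrite /evaluation size_sign_history.
Qed.

Lemma sign_historyS n w : sign_history n.+1 w =
  test_sign gamma ((evaluation (sign_history n w))^~ w) :: sign_history n w.
Proof.
by rewrite /=; congr (test_sign _ _ :: _); apply/funext => i;
  rewrite /evaluation size_sign_history.
Qed.

Lemma measurable_sign_ge (a : R) c :
  measurable ([set v | (0 <= a + v) = c] : set (measurableTypeR R)).
Proof.
have m : measurable ([set v | (0 <= a + v) = true] : set (measurableTypeR R)).
  rewrite (_ : [set _ | _] = `[- a, +oo[%classic) //.
  by apply/seteqP; split=> v /=; rewrite in_itv /= andbT -lerBlDl sub0r.
case: c => //; rewrite (_ : [set _ | _] = ~` [set v | (0 <= a + v) = true]).
  exact: measurableC.
by apply/seteqP; split=> v /=; case: (0 <= _).
Qed.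

Lemma measurable_evaluation z i c : measurable [set w | (0 <= evaluation z i w) = c].
Proof.
have := measurable_funPT (e (size z) i) measurableT _
  (measurable_sign_ge (g (query_point p z)) c).
by rewrite setTI.
Qed.

Lemma measurable_sign_history n z : measurable [set w | sign_history n w = z].
Proof.
elim: n z => [|n IH] [|b z].
- by rewrite (_ : [set _ | _] = setT) //; apply/seteqP; split.
- by rewrite (_ : [set _ | _] = set0) //; apply/seteqP; split.
- by rewrite (_ : [set _ | _] = set0) //; apply/seteqP; split.
- rewrite (_ : [set _ | _] = [set w | test_sign gamma ((evaluation z)^~ w) = b]
    `&` [set w | sign_history n w = z]).
    apply: measurableI => //; apply: measurable_test_sign => // i c.
    have mobs : measurable [set w | observed gamma ((evaluation z)^~ w) i].
      rewrite (_ : [set _ | _] = [set w | [set s | verdict gamma s = None]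
         (sign_string i ((evaluation z)^~ w))]).
        apply: measurable_countable_preimage => s.
        by apply: measurable_sign_string => *; exact: measurable_evaluation.
      by apply/seteqP; split=> w /=; rewrite -verdict_sign_string_None.
    exact: measurableI mobs (measurable_evaluation z i c).
  by apply/seteqP; split=> w; rewrite /= -/(sign_history n.+1 w) sign_historyS /=;
    [move=> [<- <-]|move=> [<- ->]].
Qed.

Let past n := past g gamma p uniform_density (fun j i => e j i) n.

(** Allows a history to be the conditioning event in [cond_iid_noise]. The measurability lemmas are
    reused on [U], the same space with the generated sigma-algebra. *)
Lemma sign_history_past n m z : (m <= n)%N -> past n [set w | sign_history m w = z].
Proof.
rewrite /past /Defs.past /=; set G := [set A | _].
pose U : measurableType _ := g_sigma_algebraType G.
suff : (m <= n)%N -> measurable ([set w | sign_history m w = z] : set U) by [].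
elim: m z => [|m IH] [|b z] mn.
- by rewrite (_ : [set _ | _] = setT) //; apply/seteqP; split.
- by rewrite (_ : [set _ | _] = set0) //; apply/seteqP; split.
- by rewrite (_ : [set _ | _] = set0) //; apply/seteqP; split.
- rewrite (_ : [set _ | _] = [set w | test_sign gamma
      ((evaluation (sign_history m w))^~ w) = b] `&` [set w | sign_history m w = z]).
    apply: (@measurableI _ U); last exact: IH (ltnW mn).
    apply: (@measurable_test_sign _ U _ _ (fun i w => evaluation (sign_history m w) i w)) => // i c.
    apply: sub_sigma_algebra; exists m, i, [set v | (0 <= 0 + v) = c].
    split=> //; first exact: measurable_sign_ge.
    by apply/seteqP; split=> w /=; rewrite pba_YE add0r.
  by apply/seteqP; split=> w; rewrite /= -/(sign_history m.+1 w) sign_historyS /=;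
    [move=> [<- <-]|move=> [<- ->]].
Qed.

Hypothesis iid : cond_iid_noise P nu g gamma p uniform_density (fun n i => e n i).

Definition history_event z := [set w | sign_history (size z) w = z].

Lemma measurable_history_event z : measurable (history_event z).
Proof. exact: measurable_sign_history. Qed.

Definition up_prob z : R :=
  fine (nu (query_point p z) [set v | (0 <= g (query_point p z) + v) = true]).

Lemma up_prob_itv z : 0 <= up_prob z <= 1.
Proof.
rewrite /up_prob fine_ge0 //= -lee_fin fineK ?fin_num_measure //.
  by apply: probability_le1; exact: measurable_sign_ge.
exact: measurable_sign_ge.
Qed.

Lemma down_prob z :
  fine (nu (query_point p z) [set v | (0 <= g (query_point p z) + v) = false])
  = 1 - up_prob z.
Proof.
rewrite (_ : [set _ | _] = ~` [set v | (0 <= g (query_point p z) + v) = true]).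
  rewrite probability_setC; last exact: measurable_sign_ge.
  by rewrite fineB ?fin_num_measure //; exact: measurable_sign_ge.
by apply/seteqP; split=> v /=; case: (0 <= _).
Qed.

Lemma prob_signs z s :
  prob P (history_event z `&` [set w | sign_string (size s) ((evaluation z)^~ w) = s])
  = prob P (history_event z) * bernoulli_weight (up_prob z) s.
Proof.
(* The index is reversed because the string carries the latest sign first. *)
pose B i : set (measurableTypeR R) :=
  [set v | (0 <= g (query_point p z) + v) = nth false s (size s - i.+1)].
have := @iid (size z) (history_event z) (query_point p z) (size s) B
  (sign_history_past z (leqnn _)) (fun i => measurable_sign_ge _ _).
have -> : history_event z `&` [set w |
    pba_X g gamma p uniform_density (fun j i => e j i w) (size z) = query_point p z]
    = history_event z.
  apply/seteqP; split=> w; first by case.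
  by move=> Hw; split=> //=; rewrite pba_XE Hw.
have -> : [set w | forall i, (i < size s)%N -> B i (e (size z) i w)] =
    [set w | sign_string (size s) ((evaluation z)^~ w) = s].
  apply/seteqP; split=> w /=.
    rewrite {}/B; elim: s => [//|b s IH] /= H; congr (_ :: _).
      by have := H (size s) (ltnSn _); rewrite subSS subnn.
    apply: IH => i si; have := H i (ltnW si).
    by rewrite subSS -(subnSK si).
  rewrite {}/B; elim: s => [//|b s IH] /= [<- sE] i.
  rewrite ltnS leq_eqVlt => /orP[/eqP ->|si].
    by rewrite subSS subnn.
  by rewrite subSS -(subnSK si) /=; apply: IH.
move=> E; rewrite /prob E fineM ?fin_num_measure //; last exact: measurable_history_event.
congr (_ * _) => /=.
clear E; rewrite {}/B; elim: s => [|b s IH].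
  by rewrite big_ord0 /bernoulli_weight mulr1.
rewrite big_ord_recr /= subSS subnn /= bernoulli_weight_cons mulrC.
congr (_ * _); first by case: b; rewrite ?down_prob.
rewrite -IH; apply: eq_bigr => i _.
by rewrite subSS -(subnSK (ltn_ord i)).
Qed.

Let sig z n w := sign_string n ((evaluation z)^~ w).

Lemma prob_sign_event z n (Q : pred (seq bool)) :
  prob P (history_event z `&` [set w | Q (sign_string n ((evaluation z)^~ w))])
  = prob P (history_event z)
    * tree_sum n (fun s => (Q s)%:R * bernoulli_weight (up_prob z) s).
Proof.
rewrite (@prob_event_tree_sum _ _ _ P (fun n w => 0 <= evaluation z n w) (sig z)) //.
- rewrite -tree_sumZ; apply: eq_tree_sum => s sn.
  by rewrite /cylinder /sig prob_signs mulrCA.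
- by move=> m s; apply: measurable_sign_string => *; exact: measurable_evaluation.
- exact: measurable_history_event.
Qed.

End Algorithm.

(** * Tightness *)

Section Tightness.
Context {R : realType} {d : measure_display} {T : measurableType d}.
Variables (P : probability T R) (g : R -> R) (xstar : R).
Variables (nu : R -> probability (measurableTypeR R) R) (gamma p : R).
Variables (e : nat -> nat -> {mfun T >-> measurableTypeR R}) (c : R).
Hypothesis gamma01 : 0 < gamma < 1.
Hypothesis pgamma : 2^-1 < p < 1 - gamma / 2.
Hypothesis iid : cond_iid_noise P nu g gamma p uniform_density (fun n i => e n i).
Hypothesis xstar01 : 0 <= xstar <= 1.
Hypothesis X_neq : \forall w \ae P, forall n,
  pba_X g gamma p uniform_density (fun j i => e j i w) n <> xstar.
Hypothesis c_gt0 : 0 < c.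
Hypothesis ptilde_ge : forall x, 0 <= x <= 1 ->
  c * `|x - xstar| <= ptilde nu g xstar x - 2^-1.

Local Notation history := (sign_history g gamma p e).
Local Notation hevent := (history_event g gamma p e).
Local Notation eval_at := (evaluation g p e).
Local Notation point := (query_point p).
Local Notation up := (up_prob g nu p).
Let pi z : R := prob P (hevent z).
Let D z : R := `|point z - xstar|.

Let p01 : 0 < p < 1.
Proof.
move: gamma01 pgamma => /andP[g0 g1] /andP[p2 pg].
by apply/andP; split; lra.
Qed.

Let point01 z : 0 <= point z <= 1.
Proof. by case: (query_pointP z p01). Qed.

Let D01 z : 0 <= D z <= 1.
Proof.
rewrite normr_ge0 ler_norml; move: (point01 z) xstar01 => /andP[? ?] /andP[? ?].
by apply/andP; split; lra.
Qed.

Let mhist z : measurable (hevent z).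
Proof. exact: measurable_history_event. Qed.

Let ptilde_up z : ptilde nu g xstar (point z) =
  if point z <= xstar then up z else 1 - up z.
Proof.
rewrite /ptilde -down_prob /up_prob; case: ifP => _; congr (fine (nu _ _));
  apply/seteqP; split=> v /=; rewrite /ztilde; case: (0 <= _) => //; lra.
Qed.

Let up_gap z : c * D z <= `|up z - 2^-1|.
Proof.
have := ptilde_ge (point01 z); rewrite ptilde_up -/(D z); case: ifP => _ H.
  exact: le_trans H (ler_norm _).
by apply: (le_trans H); rewrite -normrN; apply: le_trans (ler_norm _); lra.
Qed.

Let up_left z : point z < xstar -> 2^-1 <= up z.
Proof.
move=> h; have := ptilde_ge (point01 z); rewrite ptilde_up (ltW h) => H.
have : 0 <= c * `|point z - xstar| by rewrite mulr_ge0 // ltW.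
move: H; lra.
Qed.

Let up_right z : xstar < point z -> up z <= 2^-1.
Proof.
move=> h; have := ptilde_ge (point01 z); rewrite ptilde_up (lt_geF h) => H.
have : 0 <= c * `|point z - xstar| by rewrite mulr_ge0 // ltW.
move: H; lra.
Qed.

Let pi_ge0 z : 0 <= pi z.
Proof. exact: prob_ge0. Qed.

Let pi_nil : pi [::] = 1.
Proof.
by rewrite /pi (_ : hevent [::] = setT) ?probT //; apply/seteqP; split.
Qed.

Let bit n w := test_sign gamma ((eval_at (history n w))^~ w).

Let hist0 w : history 0 w = [::]. Proof. by []. Qed.

Let histS n w : history n.+1 w = bit n w :: history n w.
Proof. exact: sign_historyS. Qed.

Let mhistory n z : measurable [set w | history n w = z].
Proof. exact: measurable_sign_history. Qed.

Let pi_split z : pi (true :: z) + pi (false :: z) = pi z.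
Proof.
have := prob_cylinder_split P histS mhistory z measurableT.
by rewrite !setTI.
Qed.

Let pi_star z : point z = xstar -> pi z = 0.
Proof.
move=> xz; case: X_neq => N [mN PN sub].
have HN : hevent z `<=` N.
  by move=> w Hw; apply: sub => /(_ (size z)); apply; rewrite pba_XE Hw.
have N0 : prob P N = 0 by rewrite /prob PN.
by apply/eqP; rewrite eq_le pi_ge0 -N0 le_prob.
Qed.

Section Tail.
Variables (del K : R).
Hypothesis K1 : 1 <= K.
Hypothesis small_tail : forall th D M, 0 <= th <= 1 -> 0 < D <= 1 ->
  c * D <= `|th - 2^-1| ->
  tree_sum M (fun s => (`|tally_diff s : R| < boundary gamma M)%R%:R
    * bernoulli_weight th s) <= K / (M.+1%:R * D `^ (2 + del)).
Hypothesis del_gt0 : 0 < del.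

Definition no_exit z M : set T :=
  [set w | forall m, (m <= M)%N -> ~~ exits gamma ((eval_at z)^~ w) m].

Lemma measurable_no_exit z M : measurable (no_exit z M).
Proof.
rewrite (_ : no_exit z M = [set w | [set s | verdict gamma s = None]
   (sign_string M ((eval_at z)^~ w))]).
  apply: measurable_countable_preimage => s.
  by apply: measurable_sign_string => *; exact: measurable_evaluation.
by apply/seteqP; split=> w /=; rewrite -verdict_sign_string_None.
Qed.

Lemma prob_no_exit z M : 0 < D z ->
  prob P (hevent z `&` no_exit z M) <= pi z * (K / (M.+1%:R * D z `^ (2 + del))).
Proof.
move=> Dz; have /andP[D0 D1] := D01 z.
(* Time 0 is separate: the boundary is 0 there, so the walk is not below it although there is no
   exit. The bound then exceeds [pi z], since K >= 1 and D <= 1. *)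
case: M => [|M].
  apply: (@le_trans _ _ (pi z)).
    have mHN := measurableI _ _ (mhist z) (measurable_no_exit z 0).
    by apply: le_prob => // w [].
  rewrite ler_peMr // mul1r ler_pdivlMr ?powR_gt0 // mul1r (le_trans _ K1) //.
  have one (x : R) : 1 `^ x = 1 by rewrite powR1.
  by rewrite -[leRHS](one (2 + del)) ge0_ler_powR ?nnegrE ?addr_ge0 ?(ltW del_gt0).
apply: (@le_trans _ _ (prob P (hevent z `&`
    [set w | `|tally_diff (sign_string M.+1 ((eval_at z)^~ w)) : R| < boundary gamma M.+1]))).
  apply: le_prob; first by apply: measurableI => //; exact: measurable_no_exit.
    apply: measurableI => //.
    apply: (@measurable_countable_preimage _ _ _ (fun w => sign_string M.+1 ((eval_at z)^~ w))
      [set s | `|tally_diff s : R| < boundary gamma M.+1]) => s.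
    by apply: measurable_sign_string => *; exact: measurable_evaluation.
  move=> w [Hw nw]; split=> //=.
  by have := nw M.+1 (leqnn _); rewrite /exits /= walkE -ltNge.
rewrite (prob_sign_event gamma01 iid z M.+1
  (fun s => `|tally_diff s : R| < boundary gamma M.+1)).
apply: ler_wpM2l; first exact: pi_ge0.
by apply: small_tail; rewrite ?Dz //; exact: up_prob_itv.
Qed.

(** By time M either the wrong verdict has been given, with probability at most gamma / 2, or there
    has been no exit; the latter has probability O(1 / M), so M can be sent to infinity. *)
Lemma pi_wrong z b : 0 < D z -> (if b then up z <= 2^-1 else 2^-1 <= up z) ->
  pi (b :: z) <= gamma / 2 * pi z.
Proof.
move=> Dz thb.
have step M : pi (b :: z) <=
    gamma / 2 * pi z + pi z * (K / (M.+1%:R * D z `^ (2 + del))).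
  pose V := [set w | verdict gamma (sign_string M ((eval_at z)^~ w)) == Some b].
  have mV : measurable V.
    apply: (@measurable_countable_preimage _ _ _ (fun w => sign_string M ((eval_at z)^~ w))
      [set s | verdict gamma s == Some b]) => s.
    by apply: measurable_sign_string => *; exact: measurable_evaluation.
  have mHV : measurable (hevent z `&` V) by apply: measurableI.
  have mHN : measurable (hevent z `&` no_exit z M).
    by apply: measurableI => //; exact: measurable_no_exit.
  apply: (@le_trans _ _ (prob P ((hevent z `&` V) `|` (hevent z `&` no_exit z M)))).
    apply: le_prob => //; first exact: measurableU.
    move=> w; rewrite {1}/history_event /= -/(history (size z).+1 w) histS => -[bw Hw].
    rewrite /bit Hw in bw.
    case E: (verdict gamma (sign_string M ((eval_at z)^~ w))) => [v|].
      left; split=> //=; rewrite /V /= E; apply/eqP; congr Some.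
      by rewrite -bw (verdict_test_sign gamma01 E).
    by right; split=> //; apply/verdict_sign_string_None.
  apply: le_trans (probU_le P mHV mHN) _; apply: lerD; last exact: prob_no_exit.
  rewrite (prob_sign_event gamma01 iid z M (fun s => verdict gamma s == Some b)).
  rewrite [leRHS]mulrC; apply: ler_wpM2l; first exact: pi_ge0.
  apply: tree_sum_verdict_wrong => //; exact: up_prob_itv.
apply/ler_addgt0Pr => eps eps0.
pose A := pi z * (K / D z `^ (2 + del)).
have A0 : 0 <= A by rewrite mulr_ge0 // divr_ge0 ?powR_ge0 // (le_trans _ K1).
have [M HM] : exists M : nat, A / eps < M%:R.
  by exists (Num.bound (A / eps)); apply: archi_boundP; rewrite divr_ge0 // ltW.
apply: le_trans (step M) _; rewrite lerD2l.
have -> : pi z * (K / (M.+1%:R * D z `^ (2 + del))) = A / M.+1%:R.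
  by rewrite /A invfM !mulrA mulrAC.
rewrite ler_pdivrMr //; rewrite ltr_pdivrMr // in HM.
by apply: le_trans (ltW HM) _; rewrite mulrC ler_wpM2l ?(ltW eps0) // ler_nat.
Qed.

Variable a : R.
Hypothesis a01 : 0 < a <= 1.
Hypothesis del_a : 1 - del = a * (2 + 2 * del).

Let a_gt0 : 0 < a. Proof. by case/andP: a01. Qed.

Lemma pi_moment : exists2 C : R, 0 <= C & forall n,
  \sum_(m < n) tree_sum m (fun z => pi z * D z `^ del) <= C.
Proof.
have Dpos z : point z <> xstar -> 0 < D z.
  by move=> /eqP nz; rewrite /D normr_gt0 subr_eq0.
have neq z : point z < xstar \/ xstar < point z -> point z <> xstar.
  by move=> [h|h] E; move: h; rewrite E ltxx.
have /andP[p2 pg] := pgamma; have /andP[g0 g1] := gamma01.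
have pg' : p < 1 - gamma / 2 by [].
have gg : 0 < gamma / 2 by rewrite divr_gt0.
apply: (moment_sum_le p2 pg' gg xstar01 pi_ge0 pi_nil pi_split point01 _ _ _ pi_star del_gt0).
- by move=> z; case: (query_pointP z p01).
- by move=> z xz; apply: pi_wrong; [apply/Dpos/neq; right|exact: up_right].
- by move=> z xz; apply: pi_wrong; [apply/Dpos/neq; left|exact: up_left].
Qed.

Definition long_test (L : R) z : set T :=
  [set w | L * D z `^ del < (stop_time gamma ((eval_at z)^~ w))%:R `^ a * D z].

Lemma measurable_long_test L z : measurable (long_test L z).
Proof.
apply: (@measurable_countable_preimage _ _ _ (fun w => stop_time gamma ((eval_at z)^~ w))
  [set k | L * D z `^ del < k%:R `^ a * D z]) => k.
by apply: measurable_stop_time => *; exact: measurable_evaluation.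
Qed.

(* The exponents are tuned, via [del_a], so that the tail bound at test length
   (L D^(del - 1))^(1 / a) is again a multiple of D^del. *)
Lemma prob_long_test (L : R) z : 0 < L ->
  prob P (hevent z `&` long_test L z) <= K * L `^ (- a^-1) * (pi z * D z `^ del).
Proof.
move=> L0; have K0 : 0 < K by apply: lt_le_trans K1.
have [Dz|Dn] := eqVneq (D z) 0.
  rewrite (_ : _ `&` _ = set0).
    by rewrite prob0 !mulr_ge0 ?powR_ge0 ?pi_ge0 // ltW.
  apply/seteqP; split=> w // -[_]; rewrite /long_test /= Dz mulr0.
  by rewrite powR0 ?gt_eqF // mulr0 ltxx.
have Dp : 0 < D z by rewrite lt_neqAle eq_sym Dn; case/andP: (D01 z).
pose r := (L * D z `^ (del - 1)) `^ a^-1.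
have r0 : 0 < r by rewrite powR_gt0 ?mulr_gt0 ?powR_gt0.
have ra : r `^ a = L * D z `^ (del - 1).
  by rewrite -powRrM mulVf ?gt_eqF // powRr1 // mulr_ge0 ?powR_ge0 ?ltW.
(* M <= r makes a long test survive up to time M; r < M + 1 lets r replace M + 1 in the tail
   bound. *)
have /andP[Mr rM] := truncn_itv (ltW r0).
set M := Num.truncn r in Mr rM.
have sub : long_test L z `<=` no_exit z M.
  move=> w; rewrite /long_test /= => long m mM.
  apply: (noexit_of_stop_time mM); rewrite ltnNge; apply/negP => sM.
  have sr : (stop_time gamma ((eval_at z)^~ w))%:R <= r.
    by apply: le_trans Mr; rewrite ler_nat.
  have : (stop_time gamma ((eval_at z)^~ w))%:R `^ a <= r `^ a.
    by rewrite ge0_ler_powR ?nnegrE ?(ltW a_gt0) ?(ltW r0).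
  rewrite ra => /(ler_wpM2r (ltW Dp)).
  have -> : L * D z `^ (del - 1) * D z = L * D z `^ del.
    rewrite -mulrA; congr (_ * _); rewrite -{2}[D z]powRr1 ?(ltW Dp) //.
    by rewrite -powRD ?(gt_eqF Dp) ?implybT // subrK.
  by rewrite leNgt long.
apply: (@le_trans _ _ (prob P (hevent z `&` no_exit z M))).
  apply: le_prob; last exact: setIS.
    by apply: measurableI => //; exact: measurable_long_test.
  by apply: measurableI => //; exact: measurable_no_exit.
apply: le_trans (prob_no_exit M Dp) _.
rewrite [leRHS]mulrCA; apply: ler_wpM2l; first exact: pi_ge0.
(* By [del_a], (del - 1) / a = - (2 + 2 del), so the power of D left over is exactly - del. *)
have rD : r * D z `^ (2 + del) = L `^ a^-1 * D z `^ (- del).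
  rewrite /r powRM ?powR_ge0 ?(ltW L0) // -powRrM -mulrA; congr (_ * _).
  rewrite -powRD ?(gt_eqF Dp) ?implybT //; congr (_ `^ _).
  have -> : del - 1 = - (a * (2 + 2 * del)) by rewrite -del_a; lra.
  rewrite mulNr mulrAC divff ?gt_eqF //; lra.
have DD : 0 < D z `^ (2 + del) by rewrite powR_gt0.
apply: (@le_trans _ _ (K / (r * D z `^ (2 + del)))).
  rewrite ler_wpM2l ?(ltW K0) // lef_pV2 ?posrE ?mulr_gt0 // ler_wpM2r ?(ltW DD) //.
  exact: ltW.
by rewrite rD invfM -!powRN opprK mulrA.
Qed.

Let N n w := stop_time gamma ((eval_at (history n w))^~ w).

Definition long_stage L n : set T :=
  [set w | L * D (history n w) `^ del < (N n w)%:R `^ a * D (history n w)].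

Let long_stage_cylinder L z : 
  long_stage L (size z) `&` cylinder history z = hevent z `&` long_test L z.
Proof.
apply/seteqP; split=> w; rewrite /long_stage /cylinder /long_test /N /history_event /=.
  by move=> [+ Hw]; rewrite Hw.
by move=> [Hw]; rewrite Hw.
Qed.

Lemma measurable_long_stage L n : measurable (long_stage L n).
Proof.
rewrite (_ : long_stage L n = \bigcup_z
    ([set w | history n w = z] `&` long_test L z)).
  apply: countable_bigcupT_measurable => [|z]; first exact: countableP.
  by apply: measurableI => //; exact: measurable_long_test.
apply/seteqP; split=> [w ?|w [z _ [/= <- //]]].
by exists (history n w).
Qed.

Lemma prob_long_stage (L : R) n : 0 < L ->
  prob P (long_stage L n) <=
  K * L `^ (- a^-1) * tree_sum n (fun z => pi z * D z `^ del).
Proof.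
move=> L0; rewrite -(tree_sum_prob P hist0 histS mhistory n (measurable_long_stage L n)).
rewrite -tree_sumZ; apply: ler_tree_sum => z zn.
by rewrite -zn long_stage_cylinder; exact: prob_long_test.
Qed.

Fixpoint history_moment z : R :=
  if z is _ :: z' then history_moment z' + D z' `^ del else 0.

Lemma history_momentE n w :
  history_moment (history n w) = \sum_(i < n) D (history i w) `^ del.
Proof. by elim: n => [|n IH]; rewrite ?big_ord0 // big_ord_recr -IH histS. Qed.

Lemma history_moment_ge0 z : 0 <= history_moment z.
Proof. by elim: z => //= _ z IH; rewrite addr_ge0 ?powR_ge0. Qed.

Lemma tree_sum_history_moment n :
  tree_sum n (fun z => pi z * history_moment z) =
  \sum_(m < n) tree_sum m (fun z => pi z * D z `^ del).
Proof.
elim: n => [|n IH]; first by rewrite big_ord0 /= mulr0.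
rewrite big_ord_recr -IH /= -tree_sumD; apply: eq_tree_sum => z _ /=.
by rewrite -mulrDl pi_split mulrDr.
Qed.

(** Markov's inequality; the expectation of the accumulated moment is the sum of the moments of the
    stages. *)
Lemma prob_moment (C L : R) n : 0 < L ->
  (forall n, \sum_(m < n) tree_sum m (fun z => pi z * D z `^ del) <= C) ->
  prob P [set w | L < history_moment (history n w)] <= C / L.
Proof.
move=> L0 HC.
have := prob_event_tree_sum P hist0 histS mhistory n
  (fun z => L < history_moment z) measurableT.
rewrite setTI => ->; rewrite ler_pdivlMr //; apply: le_trans (HC n).
rewrite -tree_sum_history_moment mulrC -tree_sumZ; apply: ler_tree_sum => z _.
rewrite setTI -/(hevent z) -/(pi z) mulrA [leRHS]mulrC; apply: ler_wpM2r; first exact: pi_ge0.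
case: ltP => h; rewrite ?mulr1 ?mulr0 ?history_moment_ge0 //.
exact: ltW.
Qed.

Lemma prob_exists_le (B : set T) (E : nat -> set T) n :
  measurable B -> (forall i, measurable (E i)) ->
  measurable (B `|` [set w | exists2 i, (i < n)%N & E i w]) /\
  prob P (B `|` [set w | exists2 i, (i < n)%N & E i w])
  <= prob P B + \sum_(i < n) prob P (E i).
Proof.
move=> mB mE; elim: n => [|n [mU IH]].
  rewrite (_ : _ `|` _ = B) ?big_ord0 ?addr0 //.
  by apply/seteqP; split=> w; [move=> [//|[]]|left].
have -> : B `|` [set w | exists2 i, (i < n.+1)%N & E i w] =
    (B `|` [set w | exists2 i, (i < n)%N & E i w]) `|` E n.
  apply/seteqP; split=> w.
    move=> [Bw|[i]]; first by left; left.
    by rewrite ltnS leq_eqVlt => /orP[/eqP ->|lt] Ei; [right|left; right; exists i].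
  by move=> [[Bw|[i lt Ei]]|En]; [left|right; exists i => //; exact: ltnW|right; exists n].
split; first exact: measurableU.
rewrite big_ord_recr /= addrA; apply: le_trans (probU_le P mU (mE n)) _.
by rewrite lerD2r.
Qed.

Variable eps : R.
Hypothesis aE : 2^-1 - eps = a.

Let W n w := `|pba_Xhat g gamma p uniform_density eps (fun j i => e j i w) n - xstar|
    * (pba_T g gamma p uniform_density (fun j i => e j i w) n)%:R `^ a.

Let pba_NE n w : pba_N g gamma p uniform_density (fun j i => e j i w) n = N n w.
Proof. by rewrite /pba_N pba_YE. Qed.

Let W_le n w : W n w <= \sum_(i < n) (N i w)%:R `^ a * D (history i w).
Proof.
rewrite /W /pba_Xhat /pba_T aE.
under eq_bigr do rewrite pba_NE pba_XE.
under [X in _ / X]eq_bigr do rewrite pba_NE.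
under [X in X%:R]eq_bigr do rewrite pba_NE.
exact: (weighted_mean_dist (index_enum 'I_n) (fun i : 'I_n => N i w)
  (fun i : 'I_n => point (history i w))).
Qed.

(** Records all that the error depends on in a countable type, so that measurability reduces to that
    of the fibres. *)
Fixpoint run_log n w : seq (seq bool * nat) :=
  if n is n'.+1 then (history n' w, N n' w) :: run_log n' w else [::].

Lemma measurable_run_log n l : measurable [set w | run_log n w = l].
Proof.
elim: n l => [|n IH] [|[z k] l] /=.
- by rewrite (_ : [set _ | _] = setT) //; apply/seteqP; split.
- by rewrite (_ : [set _ | _] = set0) //; apply/seteqP; split.
- by rewrite (_ : [set _ | _] = set0) //; apply/seteqP; split.
rewrite (_ : [set _ | _] = [set w | history n w = z] `&`
  [set w | stop_time gamma ((eval_at z)^~ w) = k] `&` [set w | run_log n w = l]).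
  apply: measurableI => //; apply: measurableI => //.
  by apply: measurable_stop_time => *; exact: measurable_evaluation.
by apply/seteqP; split=> w /=; [move=> [<- <- <-]|move=> [[<- <-] <-]].
Qed.

Lemma sum_run_log (V : nmodType) (F : seq bool -> nat -> V) n w :
  \sum_(i < n) F (history i w) (N i w) = \sum_(x <- run_log n w) F x.1 x.2.
Proof.
elim: n => [|n IH]; first by rewrite big_ord0 big_nil.
by rewrite big_ord_recr big_cons /= IH addrC.
Qed.

Let measurable_W n : measurable_fun setT (W n).
Proof.
pose h (l : seq (seq bool * nat)) : R :=
  `|(\sum_(x <- l) x.2%:R `^ a * point x.1) / (\sum_(x <- l) x.2%:R `^ a) - xstar|
    * (\sum_(x <- l) x.2)%N%:R `^ a.
rewrite (_ : W n = fun w => h (run_log n w)).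
  by apply: measurable_fun_countable => l; exact: measurable_run_log.
apply/funext => w; rewrite /W /pba_Xhat /pba_T aE.
under eq_bigr do rewrite pba_NE pba_XE.
under [X in _ / X]eq_bigr do rewrite pba_NE.
under [X in X%:R]eq_bigr do rewrite pba_NE.
rewrite /h -(sum_run_log (fun z k => k%:R `^ a * point z)).
by rewrite -(sum_run_log (fun _ k => k%:R `^ a)) -(sum_run_log (fun _ k => k)).
Qed.

(* If no stage is long then W n <= L * \sum_i D_i^del, which is at most L^2 unless
   the moment exceeds L. *)
Lemma tight_W : tight P W.
Proof.
split=> // eta eta0; have [C C0 HC] := pi_moment.
have K0 : 0 < K by apply: lt_le_trans K1.
(* The choice gives C (1 + K) / L < eta; the summand 1 also ensures L >= 1, whence L^(-1/a) <= 1 / L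
   as a <= 1. *)
pose L := C * (1 + K) / eta + 1.
have Q0 : 0 <= C * (1 + K) / eta.
  by rewrite divr_ge0 ?(ltW eta0) // mulr_ge0 // addr_ge0 // ltW.
have L1 : 1 <= L by rewrite lerDr.
have L0 : 0 < L by apply: lt_le_trans L1.
exists (L ^+ 2) => n.
pose B := [set w | L < history_moment (history n w)].
have mB : measurable B.
  exact: (@measurable_countable_preimage _ _ _ (history n) [set z | L < history_moment z]).
have [mU U] := prob_exists_le n mB (measurable_long_stage L).
have mW : measurable [set w | L ^+ 2 < `|W n w|].
  have := @measurable_W n measurableT _ (measurable_itv `]L ^+ 2, +oo[).
  rewrite setTI (_ : W n @^-1` _ = [set w | L ^+ 2 < `|W n w|]) //.
  apply/seteqP; split=> w /=; rewrite in_itv /= andbT ger0_norm //;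
    by rewrite /W mulr_ge0 ?powR_ge0.
rewrite prob_fin // lte_fin; apply: (@le_lt_trans _ _ (C * (1 + K) / L)); last first.
  have LE : eta * L = C * (1 + K) + eta.
    by rewrite /L [LHS]mulrDr mulr1; congr (_ + _); rewrite mulrC divfK ?gt_eqF.
  by rewrite ltr_pdivrMr // LE ltrDl.
apply: (@le_trans _ _ (prob P (B `|` [set w | exists2 i, (i < n)%N & long_stage L i w]))).
  apply: le_prob => // w /=; rewrite ger0_norm; last by rewrite /W mulr_ge0 ?powR_ge0.
  move=> LW; apply: contrapT => /not_orP[/negP]; rewrite -leNgt => Bw nE.
  move: LW; apply/negP; rewrite -leNgt; apply: le_trans (W_le n w) _.
  apply: (@le_trans _ _ (\sum_(i < n) L * D (history i w) `^ del)).
    apply: ler_sum => i _; rewrite leNgt; apply/negP => Ei; apply: nE.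
    by exists i.
  by rewrite -mulr_sumr -history_momentE expr2 ler_wpM2l // ltW.
apply: (le_trans U).
have sumE : \sum_(i < n) prob P (long_stage L i) <= K * L `^ (- a^-1) * C.
  apply: (@le_trans _ _ (\sum_(i < n) K * L `^ (- a^-1) *
      tree_sum i (fun z => pi z * D z `^ del))).
    by apply: ler_sum => i _; apply: prob_long_stage.
  by rewrite -mulr_sumr ler_wpM2l ?mulr_ge0 ?powR_ge0 // ltW.
have La : L `^ (- a^-1) <= L^-1.
  rewrite -[leRHS]powR_inv1 ?(ltW L0) // ler_powR // lerN2.
  by rewrite invf_ge1 //; case/andP: a01.
apply: le_trans (lerD (prob_moment n L0 HC) sumE) _.
rewrite mulrDr mulr1 mulrDl lerD2l mulrAC (mulrC C K) ler_wpM2l //.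
by rewrite mulr_ge0 // ltW.
Qed.

End Tail.
End Tightness.

Unset Implicit Arguments.

Theorem theorem2 (R : realType) (d : measure_display) (T : measurableType d)
    (P : probability T R)
    (g : R -> R) (xstar : R)
    (nu : R -> probability (measurableTypeR R) R)
    (gamma p : R)
    (e : nat -> nat -> {mfun T >-> measurableTypeR R})
    (c eps : R) :
  let noise w := fun n i => e n i w in
  let f0 := uniform_density in
  let X n w := pba_X g gamma p f0 (noise w) n in
  let Xhat n w := pba_Xhat g gamma p f0 eps (noise w) n in
  let Ttot n w := (pba_T g gamma p f0 (noise w) n)%:R in
  0 < gamma < 1 ->
  2^-1 < p < 1 - gamma / 2 ->
  cond_iid_noise P nu g gamma p f0 (fun n i => e n i) ->
  0 <= xstar <= 1 ->
  (forall x, 0 <= x <= 1 -> x < xstar -> 0 < g x) ->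
  (forall x, 0 <= x <= 1 -> xstar < x -> g x < 0) ->
  (forall x, 0 <= x <= 1 -> x <> xstar -> 2^-1 < ptilde nu g xstar x) ->
  (\forall w \ae P, forall n, X n w <> xstar) ->
  0 < c ->
  (forall x, 0 <= x <= 1 -> c * `|x - xstar| <= ptilde nu g xstar x - 2^-1) ->
  0 < eps < 2^-1 ->
  tight P (fun (n : nat) w =>
    `|Xhat n.+1 w - xstar| * Ttot n.+1 w `^ (2^-1 - eps)).
Proof.
move=> noise f0 X Xhat Ttot g01 pg iid xs01 _ _ _ Xn c0 hc /andP[eps0 eps2].
(* This [del] is the solution of [del_a] below. *)
pose a : R := 2^-1 - eps; pose del : R := eps / (1 - eps).
have q0 : 0 < 1 - eps by lra.
have del0 : 0 < del by rewrite divr_gt0.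
have a01 : 0 < a <= 1 by apply/andP; rewrite /a; split; lra.
have del_a : 1 - del = a * (2 + 2 * del).
  by rewrite /a /del; field; exact: lt0r_neq0.
have [K K1 tail] := walk_small_tail g01 c0 del0.
have [mW tW] := tight_W g01 pg iid xs01 Xn c0 hc K1 tail del0 a01 del_a (erefl a).
split=> [n|eta /tW[M HM]]; first exact: (mW n.+1).
by exists M => n; exact: (HM n.+1).
Qed.
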